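(* Let $g\ge 2$, and suppose that the moduli spaces $M_g^{\rm trop}$ and $A_g^{\rm trop}$ and the tropical Torelli map $t_g^{\rm trop}:M_g^{\rm trop}\to A_g^{\rm trop}$ exist and have the properties (1)--(3) listed in the context. Let $J_g^{\rm trop}:=t_g^{\rm trop}(M_g^{\rm trop})$. Then the Torelli map $t_g^{\rm trop}:M_g^{\rm trop}\to J_g^{\rm trop}$ is of tropical degree one; that is: (i) the inverse image via $t_g^{\rm trop}$ of a generic point $t_g^{\rm trop}(C)$ of $J_g^{\rm trop}$ consists only of $C$; (ii) for a generic point $t_g^{\rm trop}(C)$ of $J_g^{\rm trop}$, the linear map $L_C:\mathbb R^{3g-3}\to\mathbb R^{\binom{g+1}{2}}$ is primitive, i.e. $L_C^{-1}\bigl(\mathbb Z^{\binom{g+1}{2}}\bigr)=\mathbb Z^{3g-3}$.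
   Context: All graphs are finite and connected (loops and multiple edges allowed) and all tropical curves are compact and connected. A tropical curve of genus $g\ge2$, up to tropical equivalence, is identified with a metric graph $(\Gamma,l)$, where $\Gamma$ is a graph with first Betti number $g$ all of whose vertices have valence at least $3$, and $l:E(\Gamma)\to\mathbb R_{>0}$ is a length function; metric graphs are considered up to length-preserving graph isomorphism. A graph or curve is $3$-regular if all vertices have valence $3$; then it has $3g-3$ edges. Jacobian: fix an orientation of $\Gamma$; $C_1(\Gamma,A)=\bigoplus_{e\in E(\Gamma)}A\cdot e$, $C_0(\Gamma,A)=\bigoplus_{v\in V(\Gamma)}A\cdot v$, $\partial(e)=t(e)-s(e)$ (target minus source), $H_1(\Gamma,A)=\ker\partial$; $(\cdot,\cdot)_l$ is the scalar product on $C_1(\Gamma,\mathbb R)$ with $(e,e)_l=l(e)$ and $(e,e')_l=0$ for $e\neq e'$, restricted to $H_1(\Gamma,\mathbb R)$. The principally polarized tropical Jacobian $(\operatorname{Jac}(C),\Theta_C)$ of the curve $C=(\Gamma,l)$ is identified with the flat torus $\bigl(H_1(\Gamma,\mathbb R)/H_1(\Gamma,\mathbb Z);(\cdot,\cdot)_l\bigr)$; two such are isomorphic iff there is a group isomorphism of the lattices $H_1(\cdot,\mathbb Z)$ preserving the scalar products. Assumed properties: (1) There exists a moduli space $M_g^{\rm trop}$ of dimension $3g-3$ parametrizing tropical equivalence classes of compact tropical curves of genus $g$. A generic point of $M_g^{\rm trop}$ is a $3$-regular curve. A neighborhood of a $3$-regular curve $C$ is obtained by varying the lengths of the edges of its graph,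 and is isomorphic to $\mathbb R_{>0}^{3g-3}\subset\mathbb R^{3g-3}$. Specializations of a tropical curve are obtained by letting some edge lengths go to $0$, i.e. by contracting some edges (preserving the first Betti number). (2) There exists a moduli space $A_g^{\rm trop}$ of dimension $\binom{g+1}{2}$ parametrizing principally polarized tropical abelian varieties of dimension $g$ (locally, by the entries of the symmetric $g\times g$ matrix of the scalar product). (3) The Torelli map $t_g^{\rm trop}:M_g^{\rm trop}\to A_g^{\rm trop}$, $C\mapsto(\operatorname{Jac}(C),\Theta_C)$, is a tropical map. Locally around a $3$-regular curve $C$ with graph $\Gamma$, it is the restriction of a linear map $L_C:\mathbb R^{3g-3}\to\mathbb R^{\binom{g+1}{2}}$ with $L_C(\mathbb Z^{3g-3})\subset\mathbb Z^{\binom{g+1}{2}}$; namely $L_C$ is the linear map sending $(l(e))_{e\in E(\Gamma)}$ to the entries of the symmetric matrix of $(\cdot,\cdot)_l$ with respect to a basis of $H_1(\Gamma,\mathbb Z)$. ''Generic point'' means a point varying in an open dense subset. *)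

(* Defs.v *)
From HB Require Import structures.
From mathcomp Require Import all_boot all_order all_algebra.
From mathcomp Require Import all_classical all_reals all_analysis.

Set Implicit Arguments.
Unset Strict Implicit.
Unset Printing Implicit Defensive.

Import Order.TTheory GRing.Theory Num.Theory.
Import numFieldNormedType.Exports.

Local Open Scope classical_set_scope.
Local Open Scope ring_scope.

(* Finite multigraphs; vertices and edges are numbered, so that chains and
   length functions are row vectors.  The source and target maps fix an
   orientation, which [mgraph_iso] and [contraction] may reverse edge by edge. *)
Record graph := Graph {
  nv : nat;
  ne : nat;
  src : 'I_ne -> 'I_nv;
  tgt : 'I_ne -> 'I_nv }.

Definition joins (G : graph) (e : 'I_(ne G)) (u v : 'I_(nv G)) : bool :=
  ((src e == u) && (tgt e == v)) || ((src e == v) && (tgt e == u)).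

Definition adj (G : graph) (S : pred 'I_(ne G)) : rel 'I_(nv G) :=
  [rel u v | [exists e, S e && joins e u v]].

Definition graph_connected (G : graph) : Prop :=
  (0 < nv G)%N /\ forall u v : 'I_(nv G), connect (adj predT) u v.

(* A loop contributes two to the valence. *)
Definition valence (G : graph) (v : 'I_(nv G)) : nat :=
  (#|[pred e : 'I_(ne G) | src e == v]|
   + #|[pred e : 'I_(ne G) | tgt e == v]|)%N.

Definition three_regular (G : graph) : Prop :=
  forall v : 'I_(nv G), valence v = 3%N.

(* The matrix of the boundary map, acting on the right on row vectors:
   c *m bdry G is the boundary of the 1-chain c. *)
Definition bdry (G : graph) : 'M[int]_(ne G, nv G) :=
  \matrix_(e, v) ((tgt e == v)%:R - (src e == v)%:R).

Definition betti1 (G : graph) : nat :=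
  \rank (kermx (map_mx intr (bdry G) : 'M[rat]_(ne G, nv G))).

(* The rows of B form a basis of the first integral homology lattice. *)
Definition H1_basis (g : nat) (G : graph) (B : 'M[int]_(g, ne G)) : Prop :=
  B *m bdry G = 0 /\
  forall c : 'rV[int]_(ne G), c *m bdry G = 0 ->
    exists! a : 'rV[int]_g, c = a *m B.

Definition stable_graph (g : nat) (G : graph) : Prop :=
  [/\ graph_connected G, betti1 G = g
    & forall v : 'I_(nv G), (3 <= valence v)%N].

Definition positive_lengths (R : realType) (n : nat) : set 'rV[R]_n :=
  [set l | forall e, 0 < l 0 e].

Definition tropical_curve (R : realType) (g : nat) (G : graph)
    (l : 'rV[R]_(ne G)) : Prop :=
  stable_graph g G /\ positive_lengths l.

Definition mgraph_iso (R : realType) (G G' : graph)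
    (l : 'rV[R]_(ne G)) (l' : 'rV[R]_(ne G')) : Prop :=
  exists (f : 'I_(nv G) -> 'I_(nv G')) (h : 'I_(ne G) -> 'I_(ne G')),
    [/\ bijective f, bijective h,
        forall e, joins (h e) (f (src e)) (f (tgt e))
      & forall e, l' 0 (h e) = l 0 e].

(* G' is the graph obtained from G by contracting the edges outside the image
   of h; the map h identifies the edges of G' with the surviving edges of G. *)
Definition contraction (G G' : graph) (f : 'I_(nv G) -> 'I_(nv G'))
    (h : 'I_(ne G') -> 'I_(ne G)) : Prop :=
  [/\ injective h,
      forall v', exists v, f v = v',
      forall e', joins e' (f (src (h e'))) (f (tgt (h e')))
    & forall u v, f u = f v <->
        connect (adj [pred e | e \notin codom h]) u v].

Definition extend0 (R : realType) (m n : nat) (h : 'I_m -> 'I_n)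
    (l : 'rV[R]_m) : 'rV[R]_n :=
  \row_e \sum_(e' | h e' == e) l 0 e'.

Definition scalar_product (R : realType) (n : nat) (l c d : 'rV[R]_n) : R :=
  \sum_e l 0 e * c 0 e * d 0 e.

(* The matrix of the scalar product attached to l with respect to B.  It is
   symmetric; its entries on and above the diagonal are the coordinates in the
   real space of dimension 'C(g.+1, 2). *)
Definition torelli_linear (R : realType) (g : nat) (G : graph)
    (B : 'M[int]_(g, ne G)) (l : 'rV[R]_(ne G)) : 'M[R]_g :=
  \matrix_(i, j)
    scalar_product l (map_mx intr (row i B)) (map_mx intr (row j B)).

(* The preimage of the integral points is the set of integral points.  A
   symmetric matrix has integral coordinates iff all its entries are integers. *)
Definition primitive_map (R : realType) (m g : nat)
    (L : 'rV[R]_m -> 'M[R]_g) : Prop :=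
  L @^-1` [set Q : 'M[R]_g | Q \is a mxOver Num.int]
  = [set l : 'rV[R]_m | l \is a mxOver Num.int].

(* P holds on a subset of J that is open and dense for the topology induced
   on J. *)
Definition generically (T : topologicalType) (J : set T) (P : T -> Prop)
    : Prop :=
  exists U : set T,
    [/\ open U, J `<=` closure (J `&` U) & forall x, J x -> U x -> P x].

(* M is the moduli space of tropical curves of genus g, with mcls G l the point
   of M given by the metric graph (G, l); the values of mcls outside of
   [tropical_curve] are irrelevant.
   [curve_charts]: near a 3-regular curve, M is parametrized by the edge
   lengths.  The parametrization is a continuous open map whose fibres, by
   [curve_inj], are the orbits of the automorphisms of G; requiring it to be
   injective would be inconsistent (permute the edges of the theta graph).
   [curve_limits] and [curve_specializations]: letting edge lengths tend to 0
   amounts to contracting edges, and all specializations arise in this way;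
   the first Betti number is preserved because G and G' both have genus g. *)
Record curve_moduli (R : realType) (g : nat) (M : topologicalType)
    (mcls : forall G : graph, 'rV[R]_(ne G) -> M) : Prop := CurveModuli {
  curve_surj : forall x : M, exists (G : graph) (l : 'rV[R]_(ne G)),
    tropical_curve g l /\ mcls G l = x;
  curve_inj : forall (G G' : graph) (l : 'rV[R]_(ne G)) (l' : 'rV[R]_(ne G')),
    tropical_curve g l -> tropical_curve g l' ->
    (mcls G l = mcls G' l' <-> mgraph_iso l l');
  curve_generic : generically [set: M] (fun x =>
    exists (G : graph) (l : 'rV[R]_(ne G)),
      [/\ tropical_curve g l, three_regular G & mcls G l = x]);
  curve_charts : forall G : graph, stable_graph g G -> three_regular G ->
    (forall U : set M, open U ->
       open (@positive_lengths R (ne G) `&` mcls G @^-1` U)) /\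
    (forall W : set 'rV[R]_(ne G), open W ->
       open (mcls G @` (@positive_lengths R (ne G) `&` W)));
  curve_limits : forall (G G' : graph) (f : 'I_(nv G) -> 'I_(nv G'))
      (h : 'I_(ne G') -> 'I_(ne G)) (l' : 'rV[R]_(ne G')),
    stable_graph g G -> tropical_curve g l' -> contraction f h ->
    mcls G @ within (@positive_lengths R (ne G)) (nbhs (extend0 h l'))
      --> mcls G' l';
  curve_specializations : forall (G G' : graph) (l' : 'rV[R]_(ne G')),
    stable_graph g G -> tropical_curve g l' ->
    (closure (mcls G @` @positive_lengths R (ne G)) (mcls G' l') <->
     exists (f : 'I_(nv G) -> 'I_(nv G')) (h : 'I_(ne G') -> 'I_(ne G)),
       contraction f h) }.

Definition posdef (R : realType) (g : nat) (Q : 'M[R]_g) : Prop :=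
  Q^T = Q /\ forall x : 'rV[R]_g, x != 0 -> 0 < (x *m Q *m x^T) 0 0.

(* Isometry of the lattices with Gram matrices Q and Q'. *)
Definition lattice_iso (R : realType) (g : nat) (Q Q' : 'M[R]_g) : Prop :=
  exists2 P : 'M[int]_g, P \in unitmx &
    Q' = map_mx intr P *m Q *m (map_mx intr P)^T.

(* A is the moduli space of principally polarized tropical abelian varieties
   of dimension g, with acls Q the point of A given by a lattice of rank g with
   Gram matrix Q; the values of acls outside of [posdef] are irrelevant.
   [ppav_cont] and [ppav_open]: A is parametrized by the entries of Q, through
   a continuous open map. *)
Record ppav_moduli (R : realType) (g : nat) (A : topologicalType)
    (acls : 'M[R]_g -> A) : Prop := PPAVModuli {
  ppav_surj : forall a : A, exists2 Q : 'M[R]_g, posdef Q & acls Q = a;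
  ppav_inj : forall Q Q' : 'M[R]_g, posdef Q -> posdef Q' ->
    (acls Q = acls Q' <-> lattice_iso Q Q');
  ppav_cont : forall V : set A, open V ->
    exists2 W : set 'M[R]_g, open W &
      forall Q, posdef Q -> (V (acls Q) <-> W Q);
  ppav_open : forall W : set 'M[R]_g, open W ->
    open (acls @` (@posdef R g `&` W)) }.

(* t maps a curve to its Jacobian; in the charts given by the edge lengths and
   by the entries of the Gram matrix, it is the linear map [torelli_linear]. *)
Record torelli_map (R : realType) (g : nat) (M A : topologicalType)
    (mcls : forall G : graph, 'rV[R]_(ne G) -> M) (acls : 'M[R]_g -> A)
    (t : M -> A) : Prop := TorelliMap {
  torelli_continuous : continuous t;
  torelli_jacobian : forall (G : graph) (l : 'rV[R]_(ne G))
      (B : 'M[int]_(g, ne G)),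
    tropical_curve g l -> H1_basis B ->
    t (mcls G l) = acls (torelli_linear B l) }.

(* Main.v *)
Require Import Defs.
From mathcomp Require Import all_boot all_order all_algebra.
From mathcomp Require Import all_classical all_reals all_analysis.
From mathcomp Require Import perm zify ring lra.

Set Implicit Arguments.
Unset Strict Implicit.
Unset Printing Implicit Defensive.

Import Order.TTheory GRing.Theory Num.Theory.

Local Open Scope ring_scope.

(** A curve is recovered from the Gram matrix [Q] of its Jacobian through the
    length [len x] of an integral cycle [x], the sum of [l e * |x e|] over the
    edges.  One has [len <= Q] on the lattice, and a cycle is a conformal sum of
    cycles with coefficients 0, 1, -1, for which [len] and [Q] agree.  Hence
    [len x] is the minimum of the sum of the [Q z] over the decompositions of [x]
    into lattice vectors: it depends only on [Q], monotonically.  The creases of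
    this piecewise linear function are the hyperplanes [x e = 0], and the bend
    along such a crease is the length of [e] (or the total length of the edges
    with the same functional).

    Call a cubic graph good if its edge functionals are nonzero and pairwise
    non-parallel, i.e. if it is 3-edge-connected.  If [Q] comes from a good curve,
    then so does every Gram matrix of a curve close to [Q], because the edge
    functionals that can occur near [Q] are bounded and creases persist; and the
    edges and their lengths are determined by [Q].  The stars of the vertices are
    the non-separating 3-edge cuts, so that the graph is determined as well.
    Finally, Whitehead moves turn any cubic graph into a good one without losing an
    edge functional, which makes the good points dense, and an edge of a good graph
    is the intersection of two cycles, which gives primitivity. *)

(** * Graphs and integral duality *)

(** Appending [w] to [A] leaves the left kernel unchanged, hence also the rank, so the columns of
    [w] already lie in the column span of [A]. *)
Lemma col_span_dual (F : fieldType) m n p (A : 'M[F]_(m, n)) (w : 'M[F]_(m, p)) :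
  kermx A *m w = 0 -> exists q : 'M[F]_(n, p), w = A *m q.
Proof.
move=> kAw.
have ker_eq : (kermx A <= kermx (row_mx A w))%MS.
  by apply/sub_kermxP; rewrite mul_mx_row kAw mulmx_ker row_mx0.
have rk_le : (\rank (row_mx A w) <= \rank A)%N.
  have := mxrankS ker_eq; rewrite !mxrank_ker.
  by move=> h; have := rank_leq_row A; have := rank_leq_row (row_mx A w); lia.
have sub : (A^T <= (row_mx A w)^T)%MS by rewrite tr_row_mx -addsmxE addsmxSl.
have eqA : ((row_mx A w)^T <= A^T)%MS.
  rewrite -(mxrank_leqif_sup sub) !mxrank_tr eqn_leq rk_le andbT.
  by rewrite -(mxrank_tr A) -(mxrank_tr (row_mx A w)) mxrankS.
have : (w^T <= A^T)%MS.
  by apply: submx_trans eqA; rewrite tr_row_mx -addsmxE addsmxSr.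
case/submxP=> D wE; exists D^T.
by apply: trmx_inj; rewrite wE trmx_mul trmxK.
Qed.

Lemma clear_denominators n (r : 'rV[rat]_n) :
  exists2 d : int, d != 0 & exists c : 'rV[int]_n, map_mx intr c = d%:~R *: r.
Proof.
exists (\prod_e denq (r 0 e)); first by apply/prodf_neq0 => e _; rewrite denq_neq0.
exists (\row_e (numq (r 0 e) * \prod_(f | f != e) denq (r 0 f))).
apply/rowP=> e; rewrite !mxE [in RHS](bigD1 e) //= !intrM mulrAC; congr (_ * _).
by rewrite mulrC numqE.
Qed.

(** Clearing denominators makes integral vectors enough to test the rational left kernel. With
    [A = bdry G], [q] is a vertex potential, obtained over the rationals. *)
Lemma int_dual m n (A : 'M[int]_(m, n)) (w : 'cV[int]_m) :
  (forall c : 'rV[int]_m, c *m A = 0 -> c *m w = 0) ->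
  exists q : 'cV[rat]_n, map_mx intr w = map_mx intr A *m q.
Proof.
move=> dualA; apply: col_span_dual; apply/row_matrixP => i; rewrite row0 row_mul.
set r := row i _.
have [d d0 [c cE]] := clear_denominators r.
have inj k : injective (@map_mx int rat intr 1 k).
  by move=> B C /matrixP E; apply/matrixP => a b; have := E a b; rewrite !mxE => /intr_inj.
have : c *m w = 0.
  apply: dualA; apply: inj; rewrite map_mxM cE -scalemxAl map_mx0.
  by rewrite -row_mul mulmx_ker row0 scaler0.
move/(congr1 (map_mx (intr : int -> rat))); rewrite map_mxM cE -scalemxAl map_mx0.
by move/eqP; rewrite scaler_eq0 intr_eq0 (negPf d0) => /eqP.
Qed.

Definition is_cycle (G : graph) (c : 'rV[int]_(ne G)) : Prop := c *m bdry G = 0.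

Lemma bdry_mul_col (F : pzRingType) (G : graph) (q : 'cV[F]_(nv G)) e :
  (map_mx intr (bdry G) *m q) e 0 = q (tgt e) 0 - q (src e) 0.
Proof.
rewrite mxE (eq_bigr (fun v => (tgt e == v)%:R * q v 0 - (src e == v)%:R * q v 0)); last first.
  by move=> v _; rewrite !mxE intrB !natz -!pmulrn mulrBl.
rewrite sumrB (bigD1 (tgt e)) //= eqxx mul1r big1 ?addr0; last first.
  by move=> v; rewrite eq_sym => /negPf->; rewrite mul0r.
rewrite (bigD1 (src e)) //= eqxx mul1r big1 ?addr0 //.
by move=> v; rewrite eq_sym => /negPf->; rewrite mul0r.
Qed.

Lemma cycle_potential (G : graph) (c : 'rV[int]_(ne G)) (q : 'I_(nv G) -> int) :
  is_cycle c -> \sum_e c 0 e * (q (tgt e) - q (src e)) = 0.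
Proof.
move=> cyc; have := congr1 (fun M => (M *m \col_v q v) 0 0) cyc.
rewrite -mulmxA mul0mx !mxE => h; rewrite -[RHS]h; apply: eq_bigr => e _.
have := bdry_mul_col (\col_v q v) e; rewrite !mxE => <-; congr (_ * _).
by apply: eq_bigr => v _; rewrite !mxE intz.
Qed.

Lemma connected_const (G : graph) (T : eqType) (p : 'I_(nv G) -> T) :
  graph_connected G -> (forall e, p (src e) = p (tgt e)) -> forall u v, p u = p v.
Proof.
move=> [_ conn] pe u v.
have cl : fingraph.closed (adj (G := G) predT) [pred w | p w == p u].
  move=> x y /= /existsP[e /= /orP[]/andP[/eqP<- /eqP<-]]; by rewrite !inE pe.
by have := closed_connect cl (conn u v); rewrite !inE eqxx => /esym/eqP.
Qed.

Lemma const_connected (G : graph) : (0 < nv G)%N ->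
  (forall p : 'I_(nv G) -> bool, (forall e, p (src e) = p (tgt e)) -> forall u v, p u = p v) ->
  graph_connected G.
Proof.
move=> nv0 conn; split=> // u v.
have sym : connect_sym (adj (G := G) predT).
  apply: sym_connect_sym => x y /=; apply: eq_existsb => e.
  by rewrite /joins orbC.
suff -> : connect (adj (G:=G) predT) u v = connect (adj (G:=G) predT) u u by rewrite connect0.
apply: (conn (fun w => connect (adj (G:=G) predT) u w)) => e.
apply/idP/idP => h; apply: connect_trans h _; apply: connect1;
  by apply/existsP; exists e; rewrite /joins /= !eqxx ?orbT.
Qed.

(** A half-edge is an edge with a Boolean, [true] at the target; a loop thus has two distinct
    half-edges at its vertex. *)
Definition half_end (G : graph) (x : 'I_(ne G) * bool) : 'I_(nv G) :=
  if x.2 then tgt x.1 else src x.1.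

Lemma valenceE (G : graph) v : valence v = #|[pred x : 'I_(ne G) * bool | half_end x == v]|.
Proof.
rewrite -sum1_card (eq_bigl (fun x => predT x.1 && (half_end x == v))) //.
rewrite -(pair_big_dep predT (fun e b => half_end (e, b) == v) (fun _ _ => 1%N)) /=.
under eq_bigr do rewrite big_mkcond big_bool /=.
by rewrite big_split /= -!big_mkcond /= !sum1_card addnC.
Qed.

Lemma sum_valence (G : graph) : (\sum_(v < nv G) valence v)%N = (ne G).*2.
Proof.
under eq_bigr do rewrite valenceE -sum1_card.
rewrite (exchange_big_dep predT) //=.
rewrite (eq_bigr (fun=> 1%N)); last first.
  move=> x _; rewrite (eq_bigl (pred1 (half_end x))) ?big_pred1_eq // => v.
  by rewrite /= eq_sym.
by rewrite sum1_card card_prod card_bool card_ord muln2.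
Qed.

Lemma rank_bdry (G : graph) : graph_connected G ->
  \rank (map_mx intr (bdry G) : 'M[rat]_(ne G, nv G)) = (nv G).-1.
Proof.
move=> conn; have [nv0 _] := conn.
set D := map_mx _ _.
have kerD : (kermx D^T :=: (const_mx 1 : 'rV[rat]_(nv G)))%MS.
  apply/eqmxP/andP; split; last first.
    apply/sub_kermxP/trmx_inj; rewrite trmx_mul trmxK trmx0; apply/colP => e.
    by rewrite bdry_mul_col !mxE subrr.
  apply/row_subP => i; set r := row i _.
  have : D *m r^T = 0.
    by apply: trmx_inj; rewrite trmx_mul trmxK trmx0 -row_mul mulmx_ker row0.
  move/colP => rE.
  have rc : forall u v, r 0 u = r 0 v.
    apply: (connected_const conn) => e; have := rE e.
    by rewrite bdry_mul_col !mxE => /eqP; rewrite subr_eq0 => /eqP ->.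
  have -> : r = r 0 (Ordinal nv0) *: const_mx 1.
    by apply/rowP => u; rewrite [RHS]mxE [X in _ * X]mxE mulr1; apply: rc.
  by apply: scalemx_sub.
have := mxrank_ker D^T; rewrite kerD mxrank_tr.
have -> : \rank (const_mx 1 : 'rV[rat]_(nv G)) = 1%N.
  rewrite rank_rV; case: eqP => // /rowP/(_ (Ordinal nv0)); rewrite !mxE => /eqP.
  by rewrite oner_eq0.
by have := rank_leq_col D; lia.
Qed.

Lemma stable_euler g (G : graph) : stable_graph g G -> (ne G + 1 = nv G + g)%N.
Proof.
case=> conn <- _; rewrite /betti1 mxrank_ker rank_bdry //.
have [nv0 _] := conn; have := rank_leq_row (map_mx intr (bdry G) : 'M[rat]_(ne G, nv G)).
by rewrite rank_bdry //; lia.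
Qed.

Lemma stable_ne_leq g (G : graph) : stable_graph g G -> (ne G + 3 <= 3 * g)%N.
Proof.
move=> st; have := stable_euler st; have [_ _ val3] := st.
have : (\sum_(v < nv G) 3 <= \sum_(v < nv G) valence v)%N by apply: leq_sum => v _.
by rewrite sum_valence sum_nat_const card_ord; lia.
Qed.

(** The equality case of the handshake bound [3 nv <= 2 ne], combined with the Euler relation. It
    lets an edge count certify 3-regularity for curves near a good one. *)
Lemma stable_ne_max g (G : graph) : stable_graph g G ->
  three_regular G <-> (3 * g <= ne G + 3)%N.
Proof.
move=> st; have le3 := stable_ne_leq st; have eul := stable_euler st; have [_ _ val3] := st.
have sumE := sum_valence G; split=> [reg|ne3 v].
  by move: sumE; rewrite (eq_bigr (fun=> 3%N)) // sum_nat_const card_ord; lia.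
suff : [forall v : 'I_(nv G), 3%N == valence v] by move/forallP/(_ v)/eqP.
have := leqif_sum (fun (v : 'I_(nv G)) (_ : true) => leqif_eq (val3 v)).
by case=> _ <-; rewrite sum_nat_const card_ord sumE; lia.
Qed.

(** * Conformal decompositions and bases of the homology *)

(* Following the flow c from edge to edge gives a self-map of its support; on a
   minimal stable set it is a permutation, so heads and tails cancel there. *)
Lemma cycle_piece (G : graph) (c : 'rV[int]_(ne G)) : is_cycle c -> c != 0 ->
  exists z : 'rV[int]_(ne G),
    [/\ is_cycle z, z != 0, forall e, `|z 0 e| <= 1
      & forall e, `|c 0 e - z 0 e| = `|c 0 e| - `|z 0 e|].
Proof.
move=> cyc cn0.
pose head e := if 0 < c 0 e then tgt e else src e.
pose tail e := if 0 < c 0 e then src e else tgt e.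
(* Reorient every edge along [c]: the boundary equation becomes conservation of the positive flow
   [|c|] at each vertex. *)
have balance w : \sum_e `|c 0 e| * ((head e == w)%:R - (tail e == w)%:R) = 0.
  rewrite -[RHS](cycle_potential (fun v => (v == w)%:R) cyc); apply: eq_bigr => e _.
  rewrite /head /tail; case: ltrP => [c0|c0]; first by rewrite gtr0_norm.
  by rewrite ler0_norm // mulNr -mulrN opprB.
pose S : {set 'I_(ne G)} := [set e | c 0 e != 0]%SET.
have next e : e \in S -> exists e', (e' \in S) && (tail e' == head e).
  rewrite inE => ce; apply/existsP; apply: contraT; rewrite negb_exists => /forallP noe.
  have noe' e' : c 0 e' != 0 -> (tail e' == head e) = false.
    by move=> ce'; have := noe e'; rewrite inE ce' /= => /negPf.
  have ge0 e' : true -> 0 <= `|c 0 e'| * ((head e' == head e)%:R - (tail e' == head e)%:R).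
    move=> _; have [->|ce'] := eqVneq (c 0 e') 0; first by rewrite normr0 mul0r.
    by rewrite noe' // subr0 mulr_ge0.
  have := @psumr_eq0P _ _ _ _ ge0 (balance (head e)) e isT.
  by rewrite eqxx noe' // subr0 mulr1 => /eqP; rewrite normr_eq0 (negPf ce).
pose nx e := odflt e [pick e' | (e' \in S) && (tail e' == head e)].
have nxP e : e \in S -> (nx e \in S) /\ tail (nx e) = head e.
  move=> eS; rewrite /nx; case: pickP => [e' /andP[e'S /eqP tE]|noe] //=.
  by have [e' h] := next e eS; rewrite noe in h.
pose P (A : {set 'I_(ne G)}) := [&& A != finset.set0, A \subset S & nx @: A \subset A].
have /ex_minset[W /minsetP[/and3P[Wn0 WS nxW] Wmin]] : exists A, P A.
  exists S; rewrite /P subxx /=; apply/andP; split.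
    apply: contra_neq cn0 => S0; apply/rowP => e; rewrite mxE.
    apply: contraTeq isT => ce; have : e \in S by rewrite inE.
    by rewrite S0 finset.inE.
  by apply/fintype.subsetP => _ /imsetP[e eS ->]; case: (nxP e eS).
(* The image of [W] is again stable, so minimality forces [nx] to permute [W]. *)
have nxWE : nx @: W = W.
  apply: Wmin => //; rewrite /P imsetS // (fintype.subset_trans nxW WS) !andbT.
  by have /set0Pn[e eW] := Wn0; apply/set0Pn; exists (nx e); apply: imset_f.
have nx_inj : {in W &, injective nx} by apply/imset_injP; rewrite nxWE.
pose z : 'rV[int]_(ne G) := \row_e if e \in W then (if 0 < c 0 e then 1 else -1) else 0.
have cW e : e \in W -> c 0 e != 0 by move/(fintype.subsetP WS); rewrite inE.
exists z; split.
- apply/rowP => w; rewrite !mxE.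
  rewrite (eq_bigr (fun e => if e \in W then (head e == w)%:R - (tail e == w)%:R else 0)); last first.
    move=> e _; rewrite !mxE /head /tail; case: ifP => _; last by rewrite mul0r.
    by case: ifP => _; rewrite ?mul1r // mulN1r opprB.
  rewrite -big_mkcond /= sumrB -[in X in _ - X]nxWE big_imset //=.
  apply/eqP; rewrite subr_eq0; apply/eqP; apply: eq_bigr => e eW.
  by have [_ ->] := nxP e (fintype.subsetP WS e eW).
- have /set0Pn[e eW] := Wn0; apply/eqP => /rowP/(_ e); rewrite !mxE eW.
  by case: ifP.
- by move=> e; rewrite mxE; case: ifP => // _; case: ifP.
- move=> e; rewrite mxE; case: ifP => [/cW ce|_]; last by rewrite normr0 !subr0.
  by case: ltrP => c0; lia.
Qed.

(** Splitting off a conformal piece lowers the sum of the absolute values of the entries, the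
    measure of the induction. *)
Lemma cycle_decomposition (G : graph) (c : 'rV[int]_(ne G)) : is_cycle c ->
  exists zs : seq 'rV[int]_(ne G),
    [/\ forall z, z \in zs -> [/\ is_cycle z, z != 0 & forall e, `|z 0 e| <= 1],
        c = \sum_(z <- zs) z
      & forall e, `|c 0 e| = \sum_(z <- zs) `|z 0 e|].
Proof.
have [n] := ubnP (\sum_e absz (c 0%R e))%N; elim: n c => // n IHn c cn cyc.
have [->|cn0] := eqVneq c 0.
  by exists [::]; split=> // [|e]; rewrite big_nil ?mxE ?normr0.
have [z [zc zn0 z1 zE]] := cycle_piece cyc cn0.
have [||zs [zsP zsE nE]] := IHn (c - z).
- rewrite -ltnS; apply: leq_trans cn; rewrite ltnS.
  have le e : (absz ((c - z)%R 0%R e) <= absz (c 0%R e))%N.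
    by have := zE e; rewrite !mxE; move: (c 0 e) (z 0 e) => a b; lia.
  have [e ze] : exists e, z 0 e != 0.
    apply/existsP; apply: contraT; rewrite negb_exists => /forallP ze.
    case/eqP: zn0; apply/rowP => e; rewrite mxE; apply/eqP.
    by have := ze e; rewrite negbK.
  rewrite (bigD1 e) //= [X in (_ < X)%N](bigD1 e) //= -addSn leq_add //; last first.
    by apply: leq_sum.
  by move: ze (zE e); rewrite !mxE; move: (c 0 e) (z 0 e) => a b; lia.
- by rewrite /is_cycle mulmxBl cyc zc subrr.
exists (z :: zs); split.
- by move=> y; rewrite inE => /orP[/eqP->|/zsP].
- by rewrite big_cons -zsE addrC subrK.
- by move=> e; rewrite big_cons -nE !mxE; have := zE e; move: (c 0 e) (z 0 e) => a b; lia.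
Qed.

Lemma row_span_cycles g (G : graph) (B : 'M[int]_(g, ne G)) k (X : 'M[int]_(k, ne G)) :
  H1_basis B -> X *m bdry G = 0 -> exists P : 'M[int]_(k, g), X = P *m B.
Proof.
move=> [_ gen] X0.
have /fin_all_exists[f fE] : forall i, exists a : 'rV[int]_g, row i X = a *m B.
  move=> i.
  have [|a [aE _]] := gen (row i X); first by rewrite -row_mul X0 row0.
  by exists a.
exists (\matrix_i f i); apply/row_matrixP => i.
by rewrite row_mul rowK fE.
Qed.

(** In a Smith form [L D R] of the boundary matrix, the rows of the inverse of [L] facing zero rows
    of [D] span the left kernel. The matching columns of [L] give a right inverse. *)
Lemma H1_basis_exists (G : graph) :
  exists B : 'M[int]_(betti1 G, ne G), H1_basis B /\ exists C, B *m C = 1%:M.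
Proof.
have [L Lu [R Ru [d _ bE]]] := int_Smith_normal_form (bdry G).
set D := \matrix_(i, j) _ in bE.
pose I := [pred i : 'I_(ne G) | row i D == 0].
suff [k [B [basB [C BC]]]] : exists k, exists B : 'M[int]_(k, ne G),
    H1_basis B /\ exists C, B *m C = 1%:M.
  suff kE : k = betti1 G by rewrite -kE; exists B; split=> //; exists C.
  have freeB : \rank (map_mx intr B : 'M[rat]_(k, ne G)) = k.
    apply/eqP/row_freeP; exists (map_mx intr C).
    by rewrite -map_mxM BC map_mx1.
  rewrite -{1}freeB /betti1; apply/eqmx_rank/andP; split.
    by apply/sub_kermxP; rewrite -map_mxM basB.1 map_mx0.
  apply/row_subP => i; set r := row i _.
  have [m m0 [c cE]] := clear_denominators r.
  have cyc : is_cycle c.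
    apply/matrixP => a b; apply: (@intr_inj rat).
    have : map_mx intr (c *m bdry G) = 0 :> 'M[rat]_(_, _).
      by rewrite map_mxM cE -scalemxAl -row_mul mulmx_ker row0 scaler0.
    by move/matrixP/(_ a b); rewrite !mxE.
  have [a [aE _]] := basB.2 c cyc.
  have -> : r = (m%:~R)^-1 *: map_mx intr c by rewrite cE scalerK // intr_eq0.
  by rewrite aE map_mxM scalemxAl submxMl.
pose f (i : 'I_#|I|) := enum_val i.
exists #|I|, (rowsub f (invmx L)).
have BC : rowsub f (invmx L) *m colsub f L = 1%:M.
  rewrite mul_rowsub_mx mulmx_colsub mulVmx //; apply/matrixP => i j.
  by rewrite !mxE (inj_eq enum_val_inj).
split; last by exists (colsub f L).
split.
  rewrite mul_rowsub_mx bE !mulmxA mulVmx // mul1mx; apply/row_matrixP => i.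
  rewrite row0 row_rowsub row_mul.
  by have := enum_valP i; rewrite inE => /eqP->; rewrite mul0mx.
move=> c cyc.
have cLD : c *m L *m D = 0.
  apply: (can_inj (mulmxK Ru)); rewrite mul0mx -[RHS]cyc bE !mulmxA //.
have cL0 i : i \notin I -> (c *m L) 0 i = 0.
  rewrite inE => /eqP/rowP Di; apply/eqP; apply: contraT => cLi; case: Di => j.
  rewrite !mxE; have [ij|ij] := eqVneq (i : nat) j; last by rewrite mulr0n.
  have /rowP/(_ j) := cLD; rewrite mxE (bigD1 i) //= big1 => [|i' ne]; last first.
    rewrite [D _ _]mxE -ij (_ : (i' : nat) == i = false) ?mulr0n ?mulr0 //.
    exact: negPf ne.
  rewrite addr0 [D _ _]mxE [RHS]mxE ij eqxx mulr1n => /eqP.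
  by rewrite mulf_eq0 (negPf cLi) => /eqP.
exists (c *m colsub f L); split; last by move=> a ->; rewrite -mulmxA BC mulmx1.
rewrite -[LHS]mulmx1 -(mulmxV Lu) mulmxA mulmx_colsub; apply/rowP => e.
rewrite mxE [RHS]mxE (bigID (mem I)) /= [X in _ + X]big1 ?addr0; last first.
  by move=> i /cL0->; rewrite mul0r.
rewrite [RHS](eq_bigr (fun j => (c *m L) 0 (f j) * invmx L (f j) e)); last first.
  by move=> j _; rewrite [colsub _ _ _ _]mxE [rowsub _ _ _ _]mxE.
by rewrite -(big_enum_val (fun i => (c *m L) 0 i * invmx L i e)).
Qed.

Lemma H1_basis_inj g (G : graph) (B : 'M[int]_(g, ne G)) k (X Y : 'M[int]_(k, g)) :
  H1_basis B -> X *m B = Y *m B -> X = Y.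
Proof.
move=> [B0 gen] XY; apply/row_matrixP => i.
have [|a [_ uniq]] := gen (row i X *m B); first by rewrite -mulmxA B0 mulmx0.
by rewrite -(uniq (row i X)) // -(uniq (row i Y)) // -!row_mul XY.
Qed.

Lemma H1_basis_rinv g (G : graph) (B : 'M[int]_(g, ne G)) :
  H1_basis B -> exists C, B *m C = 1%:M.
Proof.
move=> basB; have [B0 [bas0 [C0 BC0]]] := H1_basis_exists G.
have [P BP] := row_span_cycles bas0 basB.1.
have [P' BP'] := row_span_cycles basB bas0.1.
exists (C0 *m P'); rewrite mulmxA {1}BP -(mulmxA P) BC0 mulmx1.
by apply: (H1_basis_inj basB); rewrite mul1mx -mulmxA -BP' -BP.
Qed.

Lemma H1_basis_coord g (G : graph) (B : 'M[int]_(g, ne G)) (c : 'rV[int]_(ne G)) :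
  H1_basis B -> is_cycle c -> exists a : 'rV[int]_g, c = a *m B.
Proof. by move=> [_ gen] /gen[a [cE _]]; exists a. Qed.

Lemma H1_basis_cycle g (G : graph) (B : 'M[int]_(g, ne G)) (a : 'rV[int]_g) :
  H1_basis B -> is_cycle (a *m B).
Proof. by move=> [B0 _]; rewrite /is_cycle -mulmxA B0 mulmx0. Qed.

Lemma H1_basis_unit g (G : graph) (P : 'M[int]_g) (B : 'M[int]_(g, ne G)) :
  P \in unitmx -> H1_basis B -> H1_basis (P *m B).
Proof.
move=> Pu basB; split; first by rewrite -mulmxA basB.1 mulmx0.
move=> c /(H1_basis_coord basB)[a ->].
exists (a *m invmx P); split; first by rewrite mulmxA mulmxKV.
by move=> b; rewrite mulmxA => /(H1_basis_inj basB) ->; rewrite mulmxK.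
Qed.

Lemma H1_basis_decomposition g (G : graph) (B : 'M[int]_(g, ne G)) (x : 'rV[int]_g) :
  H1_basis B -> exists zs : seq 'rV[int]_g,
    [/\ forall z, z \in zs -> z != 0 /\ forall e, `|(z *m B) 0 e| <= 1,
        x = \sum_(z <- zs) z
      & forall e, `|(x *m B) 0 e| = \sum_(z <- zs) `|(z *m B) 0 e|].
Proof.
move=> basB; have [C BC] := H1_basis_rinv basB.
have [cs [csP csE cs1]] := cycle_decomposition (H1_basis_cycle x basB).
have csK c : c \in cs -> c *m C *m B = c.
  by case/csP => /(H1_basis_coord basB)[a ->] _ _; rewrite -(mulmxA a) BC mulmx1.
exists [seq c *m C | c <- cs]; split.
- move=> _ /mapP[c ccs ->]; rewrite csK //; have [_ c0 c1] := csP _ ccs.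
  by split=> //; apply: contra_neq c0 => cC; rewrite -(csK _ ccs) cC mul0mx.
- by rewrite big_map -mulmx_suml -csE -mulmxA BC mulmx1.
- by move=> e; rewrite cs1 big_map; apply: eq_big_seq => c /csK ->.
Qed.

(** * Lengths of cycles *)

(** Vanishing of the 2 by 2 minors is a decidable form of proportionality over the integers. The
    zero column is parallel to every column, which is why transitivity asks for a nonzero middle
    term. *)
Definition par g (u v : 'cV[int]_g) : bool :=
  [forall i, [forall j, u i 0 * v j 0 == u j 0 * v i 0]].

Lemma parP g (u v : 'cV[int]_g) :
  reflect (forall i j, u i 0 * v j 0 = u j 0 * v i 0) (par u v).
Proof. by apply: (iffP 'forall_forallP) => h i j; apply/eqP/h. Qed.

Lemma mulmx_par g (u v : 'cV[int]_g) (x y : 'rV[int]_g) : par u v ->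
  (x *m u) 0 0 * (y *m v) 0 0 = (y *m u) 0 0 * (x *m v) 0 0.
Proof.
move/parP => uv; rewrite !mxE !big_distrlr /= exchange_big /=.
apply: eq_bigr => i _; apply: eq_bigr => j _.
by rewrite mulrACA uv; ring.
Qed.

Lemma col_neq0 g (u : 'cV[int]_g) : u != 0 -> exists i, u i 0 != 0.
Proof.
move=> u0; apply/existsP; apply: contraT; rewrite negb_exists => /forallP ui.
by case/eqP: u0; apply/colP => i; rewrite mxE; apply/eqP; have := ui i; rewrite negbK.
Qed.

Lemma par_sym g (u v : 'cV[int]_g) : par u v = par v u.
Proof. by apply/parP/parP => h i j; rewrite mulrC -h mulrC. Qed.

Lemma par_trans g (u v w : 'cV[int]_g) : v != 0 -> par u v -> par v w -> par u w.
Proof.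
move=> /col_neq0[k vk] /parP uv /parP vw; apply/parP => i j.
apply: (mulfI vk); apply: (mulfI vk).
have -> : v k 0 * (v k 0 * (u i 0 * w j 0)) = (u i 0 * v k 0) * (v k 0 * w j 0) by ring.
have -> : v k 0 * (v k 0 * (u j 0 * w i 0)) = (u j 0 * v k 0) * (v k 0 * w i 0) by ring.
by rewrite (uv i k) (vw k j) (uv j k) (vw k i); ring.
Qed.

Lemma par_pm g (u v : 'cV[int]_g) : v = u \/ v = - u -> par u v.
Proof. by case=> ->; apply/parP => i j; rewrite ?mxE; ring. Qed.

Lemma mul_col_entry g n (x : 'rV[int]_g) (B : 'M[int]_(g, n)) e :
  (x *m col e B) 0 0 = (x *m B) 0 e.
Proof. by rewrite !mxE; apply: eq_bigr => i _; rewrite mxE. Qed.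

Lemma unit_vector_entry g n (B : 'M[int]_(g, n)) i e :
  ((delta_mx 0 i : 'rV[int]_g) *m B) 0 e = B i e.
Proof. by rewrite -rowE mxE. Qed.

Lemma seq_int_bound (T : eqType) (s : seq T) (f : T -> int) :
  exists2 k : int, 0 <= k & forall x, x \in s -> `|f x| <= k.
Proof.
elim: s => [|y s [k k0 kP]]; first by exists 0.
exists (k + `|f y|); first by rewrite addr_ge0.
by move=> x; rewrite inE => /orP[/eqP->|/kP]; rewrite ?lerDr // => h; rewrite ler_wpDr.
Qed.

Lemma test_point g (phi : 'cV[int]_g) (F : seq 'cV[int]_g) (m : int) :
  exists x : 'rV[int]_g, (x *m phi) 0 0 = 0 /\
    forall psi, psi \in F -> ~~ par phi psi -> m <= `|(x *m psi) 0 0|.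
Proof.
elim: F m => [|psi F IHF] m; first by exists 0; rewrite mul0mx mxE.
have [pp|/existsP[i /existsP[j ij]]] := boolP (par phi psi).
  have [x [x0 xF]] := IHF m; exists x; split=> // chi.
  by rewrite inE => /orP[/eqP->|/xF//]; rewrite pp.
(* [y] lies in the hyperplane [phi = 0], and its value on [psi] is the nonzero minor of indices [i],
   [j]. *)
pose y : 'rV[int]_g := phi i 0 *: delta_mx 0 j - phi j 0 *: delta_mx 0 i.
have yE (chi : 'cV[int]_g) : (y *m chi) 0 0 = phi i 0 * chi j 0 - phi j 0 * chi i 0.
  by rewrite mulmxBl -!scalemxAl -!rowE !mxE.
have [x [x0 xF]] := IHF 1.
have [k k0 kP] := seq_int_bound (psi :: F) (fun chi => (y *m chi) 0 0).
(* Where [x] vanishes, the factor [|m| + 1] of [y] suffices; elsewhere the term of [x] exceeds by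
   [|m|] anything that the term of [y] can cancel. *)
exists ((`|m| + (`|m| + 1) * k) *: x + (`|m| + 1) *: y).
have lin (chi : 'cV[int]_g) : (((`|m| + (`|m| + 1) * k) *: x + (`|m| + 1) *: y) *m chi) 0 0 =
    (`|m| + (`|m| + 1) * k) * (x *m chi) 0 0 + (`|m| + 1) * (y *m chi) 0 0.
  by rewrite mulmxDl -!scalemxAl [LHS]mxE; congr (_ + _); rewrite [LHS]mxE.
split; first by rewrite lin x0 yE; ring.
move=> chi chiF npar; rewrite lin.
have : `|(y *m chi) 0 0| <= k by apply: kP.
have : (x *m chi) 0 0 != 0 \/ (y *m chi) 0 0 != 0.
  move: chiF; rewrite inE => /orP[/eqP->|/xF/(_ npar) b1].
    by right; rewrite yE subr_eq0.
  by left; move: b1; move: ((x *m chi) 0 0) => z; lia.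
move: ((x *m chi) 0 0) ((y *m chi) 0 0) => a b ab bk.
have [a0|a0] := eqVneq a 0.
  have b0 : b != 0 by case: ab => //; rewrite a0 eqxx.
  rewrite a0 mulr0 add0r normrM; have : 1 <= `|b| by lia.
  by move: (`|b|) => b'; nia.
have A : `|m| + (`|m| + 1) * k <= `|(`|m| + (`|m| + 1) * k) * a|.
  have K0 : 0 <= `|m| + (`|m| + 1) * k by rewrite addr_ge0 ?mulr_ge0 ?addr_ge0.
  by rewrite normrM (ger0_norm K0) ler_peMr //; lia.
have Bk : `|(`|m| + 1) * b| <= (`|m| + 1) * k.
  by rewrite normrM ger0_norm ?addr_ge0 // ler_wpM2l ?addr_ge0.
move: A Bk; set u := _ * a; set v := _ * b; set w := _ * k.
by move: u v w => u v w; lia.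
Qed.

Definition bend g (x d : 'rV[int]_g) (psi : 'cV[int]_g) : int :=
  `|((x + d) *m psi) 0 0| + `|((x - d) *m psi) 0 0| - `|(x *m psi) 0 0| *+ 2.

Lemma bendN g x d (psi : 'cV[int]_g) : bend x d (- psi) = bend x d psi.
Proof.
have mN (y : 'rV[int]_g) : (y *m - psi) 0 0 = - (y *m psi) 0 0 by rewrite mulmxN mxE.
by rewrite /bend !mN !normrN.
Qed.

Lemma bend0 g x d : bend x d (0 : 'cV[int]_g) = 0.
Proof. by rewrite /bend !mulmx0 !mxE normr0. Qed.

(* The second difference (x, d) sees the crease of |psi| only along psi = phi. *)
Lemma bend_isolates g (phi : 'cV[int]_g) (F : seq 'cV[int]_g) : phi != 0 ->
  exists x d : 'rV[int]_g, 0 < bend x d phi /\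
    forall psi, psi \in F -> ~~ par phi psi -> bend x d psi = 0.
Proof.
move=> /col_neq0[i phi_i]; pose d : 'rV[int]_g := delta_mx 0 i.
have [k _ kP] := seq_int_bound F (fun psi => (d *m psi) 0 0).
(* A non-parallel functional of [F] is at least [k] in absolute value at [x] and changes by at most
   [k] along [d], so it keeps its sign between [x - d] and [x + d]. *)
have [x [x0 xF]] := test_point phi F k.
exists x, d; split.
  rewrite /bend mulmxDl mulmxBl !mxE.
  have := x0; rewrite mxE => ->.
  have -> : \sum_j d 0 j * phi j 0 = phi i 0.
    by have := unit_vector_entry phi i 0; rewrite mxE.
  by move: phi_i; move: (phi i 0) => a; lia.
move=> psi pF npar; have := kP _ pF; have := xF _ pF npar.
by rewrite /bend mulmxDl mulmxBl !mxE; move: (\sum__ _) (\sum__ _) => a b; lia.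
Qed.

Lemma bounded_cols g (N : nat) : exists F : seq 'cV[int]_g,
  forall v : 'cV[int]_g, (forall i, `|v i 0| <= N%:Z) -> v \in F.
Proof.
exists [seq (\col_i ((M i 0 : 'I_N.*2.+1)%:Z - N%:Z)) | M : 'cV['I_N.*2.+1]_g] => v vN.
apply/fintype.imageP; exists (\col_i inord (absz (v i 0 + N%:Z))) => //.
apply/colP => i; rewrite !mxE inordK; have := vN i; move: (v i 0) => a; lia.
Qed.

Lemma torelli_linearE (R : realType) g (G : graph) (B : 'M[int]_(g, ne G)) (l : 'rV[R]_(ne G)) :
  torelli_linear B l = map_mx intr B *m diag_mx l *m (map_mx intr B)^T.
Proof.
apply/matrixP => i j; rewrite !mxE /scalar_product; apply: eq_bigr => e _.
by rewrite mul_mx_diag !mxE; ring.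
Qed.

Lemma torelli_linear_form (R : realType) g (G : graph) (B : 'M[int]_(g, ne G))
    (l : 'rV[R]_(ne G)) (x y : 'rV[R]_g) :
  (x *m torelli_linear B l *m y^T) 0 0 =
  \sum_e l 0 e * (x *m map_mx intr B) 0 e * (y *m map_mx intr B) 0 e.
Proof.
rewrite torelli_linearE.
have -> : x *m (map_mx intr B *m diag_mx l *m (map_mx intr B)^T) *m y^T =
    (x *m map_mx intr B) *m diag_mx l *m (y *m map_mx intr B)^T by rewrite trmx_mul !mulmxA.
rewrite mul_mx_diag mxE; apply: eq_bigr => e _.
by rewrite [(_^T) e 0]mxE [X in X * _ = _]mxE [X in X * _]mulrC.
Qed.

Definition qform (R : realType) g (Q : 'M[R]_g) (x : 'rV[int]_g) : R :=
  (map_mx intr x *m Q *m (map_mx intr x)^T) 0 0.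

Definition len (R : realType) g (G : graph) (B : 'M[int]_(g, ne G)) (l : 'rV[R]_(ne G))
    (x : 'rV[int]_g) : R :=
  \sum_e l 0 e * `|(x *m B) 0 e|%:~R.

Lemma qformE (R : realType) g (G : graph) (B : 'M[int]_(g, ne G)) (l : 'rV[R]_(ne G)) x :
  qform (torelli_linear B l) x = \sum_e l 0 e * ((x *m B) 0 e ^+ 2)%:~R.
Proof.
rewrite /qform torelli_linear_form; apply: eq_bigr => e _.
by rewrite -map_mxM [map_mx _ _ _ _]mxE -mulrA -intrM expr2.
Qed.

Lemma len_le_qform (R : realType) g (G : graph) (B : 'M[int]_(g, ne G)) (l : 'rV[R]_(ne G)) x :
  positive_lengths l -> len B l x <= qform (torelli_linear B l) x.
Proof.
move=> l0; rewrite qformE; apply: ler_sum => e _; rewrite ler_pM2l; last exact: l0.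
by rewrite ler_int; move: ((x *m B) 0 e) => a; nia.
Qed.

Lemma len_sum (R : realType) g (G : graph) (B : 'M[int]_(g, ne G)) (l : 'rV[R]_(ne G)) zs :
  positive_lengths l -> len B l (\sum_(z <- zs) z) <= \sum_(z <- zs) len B l z.
Proof.
move=> l0; elim: zs => [|z zs IH].
  by rewrite !big_nil /len big1 // => e _; rewrite mul0mx mxE normr0 mulr0.
rewrite !big_cons; apply: le_trans (_ : _ <= len B l z + len B l (\sum_(j <- zs) j)) _; last first.
  by rewrite lerD2l.
rewrite /len -big_split; apply: ler_sum => e _ /=.
rewrite -mulrDr ler_pM2l; last exact: l0.
by rewrite -intrD ler_int mulmxDl mxE ler_normD.
Qed.

(** On pieces with entries 0, 1, -1 length and norm agree. Each piece contributes at most one to an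
    entry, so the number of pieces bounds the entries; this later bounds the columns of [B]. *)
Lemma len_qform_decomposition (R : realType) g (G : graph) (B : 'M[int]_(g, ne G))
    (l : 'rV[R]_(ne G)) x : H1_basis B ->
  exists zs : seq 'rV[int]_g,
    [/\ forall z, z \in zs -> z != 0, x = \sum_(z <- zs) z,
        forall e, `|(x *m B) 0 e| <= (size zs)%:Z
      & len B l x = \sum_(z <- zs) qform (torelli_linear B l) z].
Proof.
move=> basB; have [zs [zsP zsE zs1]] := H1_basis_decomposition x basB.
exists zs; split=> //; first by move=> z /zsP[].
  move=> e; rewrite zs1; elim: zs zsP {zsE zs1} => [|z zs IH] zsP; first by rewrite big_nil.
  rewrite big_cons [size _]/= -[(size zs).+1]add1n PoszD; apply: lerD.
    by case: (zsP z (mem_head _ _)).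
  by apply: IH => y yzs; apply: zsP; rewrite inE yzs orbT.
under eq_bigr do rewrite qformE.
rewrite exchange_big /=; apply: eq_bigr => e _.
rewrite zs1 -mulr_sumr raddf_sum; congr (_ * _); apply: eq_big_seq => z /zsP[_ /(_ e)].
by move: (_ 0 e) => a a1; congr (_%:~R); nia.
Qed.

(* The length is determined by the norms of lattice vectors, monotonically:
   decompose x for l0 and use subadditivity for l. *)
Lemma len_compare (R : realType) g (G G0 : graph) (B : 'M[int]_(g, ne G))
    (B0 : 'M[int]_(g, ne G0)) (l : 'rV[R]_(ne G)) (l0 : 'rV[R]_(ne G0)) (k : R) :
  positive_lengths l -> H1_basis B0 ->
  (forall z, qform (torelli_linear B l) z <= k * qform (torelli_linear B0 l0) z) ->
  forall x, len B l x <= k * len B0 l0 x.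
Proof.
move=> lpos basB0 le x; have [zs [_ xE _ ->]] := len_qform_decomposition l0 x basB0.
rewrite {1}xE mulr_sumr; apply: le_trans (len_sum _ _ lpos) _.
by apply: ler_sum => z _; apply: le_trans (len_le_qform _ _ lpos) (le z).
Qed.

Lemma len_bend (R : realType) g (G : graph) (B : 'M[int]_(g, ne G)) (l : 'rV[R]_(ne G)) x d :
  \sum_e l 0 e * (bend x d (col e B))%:~R =
  len B l (x + d) + len B l (x - d) - len B l x *+ 2.
Proof.
rewrite /len -big_split /= -sumrMnl -sumrB; apply: eq_bigr => e _.
by rewrite /bend !mul_col_entry !mulr2n intrB !intrD; ring.
Qed.

(** * Recovering the edges from the Gram matrix *)

(** A column of [B] is the functional reading off one coefficient of a cycle. In a connected graph a
    zero column marks a bridge, and two parallel nonzero columns mark a 2-edge cut. *)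
Definition simple_basis g n (B : 'M[int]_(g, n)) : Prop :=
  (forall e, col e B != 0) /\ (forall e f, e != f -> ~~ par (col e B) (col f B)).

(** Decompose a coordinate vector on which the functional of [e] is nonzero: some piece meets [e],
    and its value there is 1 or -1. *)
Lemma short_unit_functional g (G : graph) (B : 'M[int]_(g, ne G)) e :
  H1_basis B -> col e B != 0 -> exists x : 'rV[int]_g,
    (x *m B) 0 e = 1 /\ forall f, `|(x *m B) 0 f| <= 1.
Proof.
move=> basB /col_neq0[i]; rewrite mxE => Bie.
have [zs [zsP _ zs1]] := H1_basis_decomposition (delta_mx 0 i) basB.
have /hasP[z zzs ze] : has (fun z : 'rV[int]_g => (z *m B) 0 e != 0) zs.
  apply: contraT => /hasPn zs0; move: (zs1 e); rewrite unit_vector_entry.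
  rewrite big1_seq => [/eqP|z /= /zs0]; first by rewrite normr_eq0 (negPf Bie).
  by rewrite negbK => /eqP ->; rewrite normr0.
have [_ z1] := zsP z zzs.
have [zE|zE] : (z *m B) 0 e = 1 \/ (z *m B) 0 e = -1.
  by move: ((z *m B) 0 e) ze (z1 e) => a; lia.
  by exists z.
by exists (- z); split=> [|f]; rewrite mulNmx mxE ?zE // normrN.
Qed.

Lemma unit_functional g (G : graph) (B : 'M[int]_(g, ne G)) e :
  H1_basis B -> col e B != 0 -> exists x : 'rV[int]_g, (x *m B) 0 e = 1.
Proof. by move=> basB /(short_unit_functional basB)[x [xe _]]; exists x. Qed.

(** Both functionals take the value 1, so the factor between them is an integer with an integral
    inverse. *)
Lemma par_primitive g (G G' : graph) (B : 'M[int]_(g, ne G)) (B' : 'M[int]_(g, ne G')) e e' :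
  H1_basis B -> H1_basis B' -> col e B != 0 -> col e' B' != 0 ->
  par (col e B) (col e' B') -> col e' B' = col e B \/ col e' B' = - col e B.
Proof.
move=> basB basB' e0 e'0 pe.
have [x xe] := unit_functional basB e0; have [y ye] := unit_functional basB' e'0.
have E (z : 'rV[int]_g) : (z *m B') 0 e' = (z *m B) 0 e * (x *m B') 0 e'.
  by have := mulmx_par x z pe; rewrite !mul_col_entry xe mul1r.
have unit : (y *m B) 0 e * (x *m B') 0 e' = 1 by rewrite -E.
have colE i : col e' B' i 0 = col e B i 0 * (x *m B') 0 e'.
  by have := E (delta_mx 0 i); rewrite !unit_vector_entry !mxE.
have [c1|c1] : (x *m B') 0 e' = 1 \/ (x *m B') 0 e' = -1.
- move/(congr1 absz): unit; rewrite abszM => /eqP; rewrite muln_eq1 => /andP[_ /eqP].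
  by move: ((x *m B') 0 e') => a; lia.
- by left; apply/colP => i; rewrite colE c1 mulr1.
- by right; apply/colP => i; rewrite colE c1 mulrN1 [RHS]mxE.
Qed.

Lemma simple_basisP g (G : graph) (B : 'M[int]_(g, ne G)) : H1_basis B ->
  (forall e, col e B != 0) ->
  (forall e f, e != f -> col f B <> col e B /\ col f B <> - col e B) -> simple_basis B.
Proof.
move=> basB B0 Bpm; split=> // e f ef; apply/negP => /(par_primitive basB basB (B0 e) (B0 f)).
by have [n1 n2] := Bpm e f ef; case.
Qed.

Lemma bend_neq0_col g n (B : 'M[int]_(g, n)) x d f : bend x d (col f B) != 0 -> col f B != 0.
Proof. by apply: contra_neq => ->; rewrite bend0. Qed.

Lemma len_bend_isolated (R : realType) g (G : graph) (B : 'M[int]_(g, ne G)) (l : 'rV[R]_(ne G))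
    (phi : 'cV[int]_g) x d f : phi != 0 -> simple_basis B -> par phi (col f B) ->
  (forall e, ~~ par phi (col e B) -> bend x d (col e B) = 0) ->
  len B l (x + d) + len B l (x - d) - len B l x *+ 2 = l 0 f * (bend x d (col f B))%:~R.
Proof.
move=> phi0 [_ simB] pf iso; rewrite -len_bend (bigD1 f) //= big1 ?addr0 // => e ef.
rewrite iso ?mulr0 //; apply: contra (simB _ _ ef) => pe.
by apply: par_trans (pf) => //; rewrite par_sym.
Qed.

Lemma torelli_edges (R : realType) g (G G' : graph) (B : 'M[int]_(g, ne G))
    (B' : 'M[int]_(g, ne G')) (l : 'rV[R]_(ne G)) (l' : 'rV[R]_(ne G')) :
  H1_basis B -> H1_basis B' -> simple_basis B -> simple_basis B' ->
  positive_lengths l -> positive_lengths l' ->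
  torelli_linear B l = torelli_linear B' l' ->
  exists h : 'I_(ne G) -> 'I_(ne G'), injective h /\
    forall e, l' 0 (h e) = l 0 e /\ (col (h e) B' = col e B \/ col (h e) B' = - col e B).
Proof.
move=> basB basB' simB simB' lp lp' QE.
have lenE x : len B l x = len B' l' x.
  apply/le_anti/andP; split; rewrite -[leRHS]mul1r; apply: len_compare => // z;
    by rewrite QE mul1r.
have /fin_all_exists[h hP] : forall e, exists f,
    l' 0 f = l 0 e /\ (col f B' = col e B \/ col f B' = - col e B).
  move=> e; have e0 := simB.1 e.
  have [x [d [pos iso]]] :=
    bend_isolates ([seq col f B | f : 'I_(ne G)] ++ [seq col f B' | f : 'I_(ne G')]) e0.
  have isoB f : ~~ par (col e B) (col f B) -> bend x d (col f B) = 0.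
    by apply: iso; rewrite mem_cat fintype.image_f.
  have isoB' f : ~~ par (col e B) (col f B') -> bend x d (col f B') = 0.
    by apply: iso; rewrite mem_cat fintype.image_f ?orbT.
  have pee : par (col e B) (col e B) by apply: par_pm; left.
  have DE := len_bend_isolated l e0 simB pee isoB.
  have Dpos : 0 < l 0 e * (bend x d (col e B))%:~R.
    by rewrite mulr_gt0 ?ltr0z //; apply: lp.
  (* Without a functional of [B'] parallel to that of [e], the same second difference computed in
     [B'] would vanish. *)
  have /existsP[f fP] : [exists f, par (col e B) (col f B')].
    apply: contraT; rewrite negb_exists => /forallP np; move: Dpos.
    by rewrite -DE !lenE -len_bend big1 ?ltxx // => f _; rewrite isoB' ?mulr0.
  have pm := par_primitive basB basB' e0 (simB'.1 f) fP.
  exists f; split=> //.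
  have := len_bend_isolated l' e0 simB' fP isoB'; rewrite -!lenE DE.
  have -> : bend x d (col f B') = bend x d (col e B) by case: pm => ->; rewrite ?bendN.
  by move=> /mulIf -> //; rewrite intr_eq0 gt_eqF.
exists h; split=> // e f hef; apply/eqP; apply: contraT => ef.
case/negP: (simB.2 _ _ ef).
have p1 := par_pm (hP e).2; have p2 := par_pm (hP f).2.
apply: par_trans (simB'.1 (h e)) p1 _; by rewrite hef par_sym.
Qed.

Lemma finite_lower_bound (R : realType) (I : finType) (t : I -> R) :
  (forall i, 0 < t i) -> exists2 m : R, 0 < m & forall i, m <= t i.
Proof.
move=> t0; exists ((1 + \sum_i (t i)^-1)^-1).
  by rewrite invr_gt0 ltr_pwDl // sumr_ge0 // => i _; rewrite invr_ge0 ltW.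
move=> i; rewrite -[leRHS]invrK lef_pV2 ?posrE ?invr_gt0 //; last first.
  by rewrite ltr_pwDl // sumr_ge0 // => j _; rewrite invr_ge0 ltW.
rewrite (bigD1 i) //= addrCA lerDl addr_ge0 // sumr_ge0 // => j _.
by rewrite invr_ge0 ltW.
Qed.

Lemma finite_nat_bound (R : realType) (I : finType) (t : I -> R) :
  exists N : nat, forall i, t i <= N%:R.
Proof.
exists (\sum_i Num.bound `|t i|)%N => i; rewrite (bigD1 i) //= natrD ler_wpDr //.
by apply: le_trans (ler_norm _) (ltW _); apply: archi_boundP.
Qed.

Lemma qform_lower_bound (R : realType) g (G : graph) (B : 'M[int]_(g, ne G)) (l : 'rV[R]_(ne G)) :
  H1_basis B -> positive_lengths l ->
  exists2 m : R, 0 < m & forall z, z != 0 -> m <= qform (torelli_linear B l) z.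
Proof.
move=> basB lp; have [m m0 mP] := finite_lower_bound lp; exists m => // z z0.
have [e ze] : exists e, (z *m B) 0 e != 0.
  apply/existsP; apply: contraT; rewrite negb_exists => /forallP ze; case/eqP: z0.
  apply: (H1_basis_inj basB); rewrite mul0mx; apply/rowP => e; rewrite [RHS]mxE.
  by apply/eqP; have := ze e; rewrite negbK.
rewrite qformE (bigD1 e) //=; apply: ler_wpDr.
  by apply: sumr_ge0 => f _; rewrite mulr_ge0 ?ler0z ?sqr_ge0 // ltW //; apply: lp.
apply: le_trans (mP e) _; rewrite ler_peMr ?ler1z //; first by rewrite ltW //; apply: lp.
by move: ((z *m B) 0 e) ze => a; nia.
Qed.

(** A decomposition of the [i]-th unit vector has at least [|B i e|] pieces, each of norm at least
    [m]; their norms add up to the length of that vector, which is at most its norm. The bound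
    involves the Gram matrix only. *)
Lemma column_bound (R : realType) g (G : graph) (B : 'M[int]_(g, ne G)) (l : 'rV[R]_(ne G)) (m : R) :
  H1_basis B -> positive_lengths l -> 0 < m ->
  (forall z, z != 0 -> m <= qform (torelli_linear B l) z) ->
  forall i e, `|B i e|%:~R * m <= qform (torelli_linear B l) (delta_mx 0 i).
Proof.
move=> basB lp m0 mP i e; have [zs [zs0 _ zs1 zsE]] := len_qform_decomposition l (delta_mx 0 i) basB.
apply: le_trans (len_le_qform _ _ lp); rewrite zsE.
have := zs1 e; rewrite unit_vector_entry -(ler_int R) -(ler_pM2r m0) => /le_trans; apply.
rewrite -pmulrn mulr_natl; elim: zs zs0 {zs1 zsE} => [|z zs IH] zs0; first by rewrite big_nil.
rewrite big_cons /= mulrS lerD ?mP ?zs0 ?mem_head // IH // => y yzs.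
by rewrite zs0 // inE yzs orbT.
Qed.

(** Near the given Gram matrix the columns have bounded entries, hence come from a finite list fixed
    in advance. One second difference per edge isolates its crease within that list, and a small
    relative error cannot cancel the positive bend. The edge count then leaves no room for further
    or repeated functionals. *)
Lemma simple_basis_near (R : realType) g (G0 : graph) (B0 : 'M[int]_(g, ne G0))
    (l0 : 'rV[R]_(ne G0)) :
  H1_basis B0 -> simple_basis B0 -> positive_lengths l0 ->
  exists2 dl : R, 0 < dl & forall (G : graph) (B : 'M[int]_(g, ne G)) (l : 'rV[R]_(ne G)),
    H1_basis B -> positive_lengths l -> (ne G <= ne G0)%N ->
    (forall z, (1 - dl) * qform (torelli_linear B0 l0) z <= qform (torelli_linear B l) z
               <= (1 + dl) * qform (torelli_linear B0 l0) z) ->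
    ne G = ne G0 /\ simple_basis B.
Proof.
move=> bas0 sim0 lp0; set Q0 := torelli_linear B0 l0.
have [m m0 mP] := qform_lower_bound bas0 lp0.
(* For [dl <= 1/2] the norms grow at most by 3/2 and the lower bound [m] shrinks at most by half,
   whence the factor 3. *)
have [N NP] := finite_nat_bound (fun i : 'I_g => 3 * qform Q0 (delta_mx 0 i) / m).
have [F FP] := bounded_cols g N.
have /fin_all_exists[p pP] : forall e : 'I_(ne G0), exists p : 'rV[int]_g * 'rV[int]_g,
    0 < bend p.1 p.2 (col e B0) /\
    forall psi, psi \in F ++ [seq col f B0 | f : 'I_(ne G0)] ->
      ~~ par (col e B0) psi -> bend p.1 p.2 psi = 0.
  move=> e; have [x [d xd]] :=
    bend_isolates (F ++ [seq col f B0 | f : 'I_(ne G0)]) (sim0.1 e).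
  by exists (x, d).
pose L := len B0 l0.
pose T e := l0 0 e * (bend (p e).1 (p e).2 (col e B0))%:~R.
pose S e := L ((p e).1 + (p e).2) + L ((p e).1 - (p e).2) + L (p e).1 *+ 2.
have L0 x : 0 <= L x.
  by apply: sumr_ge0 => e _; rewrite mulr_ge0 ?ler0z // ltW //; apply: lp0.
have S0 e : 0 <= S e by rewrite !addr_ge0 ?mulrn_wge0.
have TE e : L ((p e).1 + (p e).2) + L ((p e).1 - (p e).2) - L (p e).1 *+ 2 = T e.
  apply: len_bend_isolated (sim0.1 e) sim0 _ _; first by apply: par_pm; left.
  by move=> f; apply: (pP e).2; rewrite mem_cat fintype.image_f ?orbT.
have T0 e : 0 < T e by rewrite mulr_gt0 ?ltr0z ?(pP e).1 //; apply: lp0.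
(* [S e] adds up the absolute values of the terms of the second difference, so [dl * S e] bounds the
   loss of bend. *)
have [dl dl0 dlP] : exists2 dl : R, 0 < dl & dl <= 1 / 2 /\ forall e, dl * S e < T e.
  have [d d0 dP] : exists2 d : R, 0 < d & forall e, d <= T e / (S e + 1).
    by apply: finite_lower_bound => e; rewrite divr_gt0 // ltr_wpDl.
  exists (Num.min d (1 / 2)); first by rewrite lt_min d0 divr_gt0.
  split; first by rewrite ge_min lexx orbT.
  move=> e; have S1 : 0 < S e + 1 by rewrite ltr_wpDl.
  apply: le_lt_trans (_ : T e / (S e + 1) * S e < _).
    by rewrite ler_wpM2r // ge_min dP.
  by rewrite mulrAC ltr_pdivrMr // ltr_pM2l // ltrDl.
exists dl => // G B l basB lp neG near.
have qpos z : z != 0 -> m / 2 <= qform (torelli_linear B l) z.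
  move=> z0; have /andP[le _] := near z; have := mP z z0; have := dlP.1; nra.
have BN i f : `|B i f| <= N%:Z.
  have := column_bound basB lp (divr_gt0 m0 (ltr0Sn _ 1)) qpos i f.
  have /andP[_ le] := near (delta_mx 0 i); have := NP i; rewrite ler_pdivrMr // => NPi.
  have q0 : 0 <= qform Q0 (delta_mx 0 i).
    by apply: le_trans (len_le_qform _ _ lp0); apply: L0.
  have := dlP.1 => dlh bd; rewrite -(ler_int R) -(ler_pM2r m0).
  apply: le_trans NPi; nra.
have colF f : col f B \in F by apply: FP => i; rewrite mxE BN.
have isoB e f : bend (p e).1 (p e).2 (col f B) != 0 -> par (col e B0) (col f B).
  by apply: contraR => np; rewrite (pP e).2 // mem_cat colF.
have le1 x : (1 - dl) * L x <= len B l x.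
  have d1 : 0 < 1 - dl by have := dlP.1; lra.
  rewrite -ler_pdivlMl //; apply: len_compare => // z.
  by rewrite ler_pdivlMl //; case/andP: (near z).
have le2 x : len B l x <= (1 + dl) * L x.
  by apply: len_compare => // z; case/andP: (near z).
(* The bend at [e] persists in [B], and only a nonzero column parallel to that of [e] can produce
   it. *)
have /fin_all_exists[h hP] : forall e, exists f, par (col e B0) (col f B) /\ col f B != 0.
  move=> e; have /existsP[f fP] : [exists f, bend (p e).1 (p e).2 (col f B) != 0].
    apply: contraT; rewrite negb_exists => /forallP b0.
    have := len_bend B l (p e).1 (p e).2; rewrite big1 => [|f _]; last first.
      by have := b0 f; rewrite negbK => /eqP ->; rewrite mulr0.
    have := dlP.2 e; have := TE e; rewrite /S.
    have := le1 ((p e).1 + (p e).2); have := le1 ((p e).1 - (p e).2); have := le2 (p e).1.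
    move: (L _) (L _) (L _) (len _ _ _) (len _ _ _) (len _ _ _) (T e) => a b c a' b' c' t.
    rewrite !mulr2n; nra.
  by exists f; rewrite isoB // (bend_neq0_col fP).
have h_inj : injective h.
  move=> e f hef; apply/eqP; apply: contraT => ef; case/negP: (sim0.2 _ _ ef).
  apply: par_trans (hP e).2 (hP e).1 _; rewrite hef par_sym; exact: (hP f).1.
have neE : ne G = ne G0.
  apply/eqP; rewrite eqn_leq neG /=; have := leq_card h h_inj; by rewrite !card_ord.
split=> //; have [k hk kh] : bijective h by apply: inj_card_bij => //; rewrite !card_ord neE.
split=> [f|e f ef]; first by rewrite -(kh f) (hP (k f)).2.
apply: contra (sim0.2 (k e) (k f) _) => [pef|]; last by rewrite (inj_eq (can_inj kh)).
have := (hP (k e)).1; have := (hP (k f)).1; rewrite !kh => pf pe.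
have e0 := (hP (k e)).2; have f0 := (hP (k f)).2; rewrite !kh in e0 f0.
by apply: par_trans e0 pe _; apply: par_trans f0 pef _; rewrite par_sym.
Qed.

(** * Recovering the graph from its cycles *)

Definition cut (G : graph) (X : pred 'I_(nv G)) : {set 'I_(ne G)} :=
  [set e | X (src e) != X (tgt e)]%SET.

Definition star (G : graph) (v : 'I_(nv G)) : {set 'I_(ne G)} :=
  [set e | (src e == v) || (tgt e == v)]%SET.

Lemma bdryE (G : graph) e v : bdry G e v = (tgt e == v)%:R - (src e == v)%:R.
Proof. by rewrite mxE. Qed.

Lemma cut_cycle_sum (G : graph) (X : pred 'I_(nv G)) (c : 'rV[int]_(ne G)) : is_cycle c ->
  \sum_(e in cut X) c 0 e * ((X (tgt e))%:R - (X (src e))%:R) = 0.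
Proof.
move=> cyc; rewrite -[RHS](cycle_potential (fun v => (X v)%:R) cyc) big_mkcond /=.
apply: eq_bigr => e _; rewrite inE; case: eqVneq => //= ->; by rewrite subrr mulr0.
Qed.

(** An empty cut contradicts connectedness. A single cut edge carries no flow, so its column is
    zero; two cut edges carry opposite flows across the cut, so their columns are parallel. *)
Lemma cut_ge3 g (G : graph) (B : 'M[int]_(g, ne G)) (X : pred 'I_(nv G)) u v :
  graph_connected G -> H1_basis B -> simple_basis B -> X u -> ~~ X v ->
  (3 <= #|cut X|)%N.
Proof.
move=> conn basB [B0 Bpar] Xu Xv; rewrite leqNgt; apply/negP => lt3.
have cyc i : is_cycle (row i B).
  by rewrite rowE; apply: H1_basis_cycle.
have sgn e : e \in cut X -> (X (tgt e))%:R - (X (src e))%:R = 1 :> int \/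
    (X (tgt e))%:R - (X (src e))%:R = -1 :> int.
  by rewrite inE; case: (X (src e)); case: (X (tgt e)) => //= _; [right|left].
have : (#|cut X| == 0) || (#|cut X| == 1) || (#|cut X| == 2) by lia.
case/orP => [/orP[]|].
- rewrite cards_eq0 => /eqP cut0; have := connected_const (p := X) conn.
  move=> /(_ _ u v); rewrite Xu (negPf Xv) => h; suff: true = false by [].
  apply: h => e; apply/eqP; apply: contraT => ce.
  have : e \in cut X by rewrite inE.
  by rewrite cut0 finset.inE.
- case/cards1P => e cutE; case/eqP: (B0 e); apply/colP => i; rewrite [RHS]mxE.
  have := cut_cycle_sum X (cyc i); rewrite cutE big_set1 !mxE.
  by case: (sgn e) => [|->|->]; rewrite ?cutE ?set11 ?mulr1 ?mulrN1 // => /eqP; rewrite oppr_eq0 => /eqP.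
- case/cards2P => e [f [ef cutE]]; case/negP: (Bpar _ _ ef).
  have se : e \in cut X by rewrite cutE !inE eqxx.
  have sf : f \in cut X by rewrite cutE !inE eqxx orbT.
  have E i : B i e * ((X (tgt e))%:R - (X (src e))%:R) + B i f * ((X (tgt f))%:R - (X (src f))%:R) = 0.
    have := cut_cycle_sum X (cyc i); rewrite cutE big_setU1 ?big_set1 ?inE //.
    by rewrite ![row _ _ _ _]mxE.
  apply/parP => i j; rewrite !mxE; have := E i; have := E j.
  case: (sgn e se) => ->; case: (sgn f sf) => ->; rewrite !(mulr1, mulrN1);
  move: (B i e) (B i f) (B j e) (B j f) => a b c d h1 h2.
  + by have -> : b = - a by [lia]; have -> : d = - c by [lia]; ring.
  + by have -> : b = a by [lia]; have -> : d = c by [lia]; ring.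
  + by have -> : b = a by [lia]; have -> : d = c by [lia]; ring.
  + by have -> : b = - a by [lia]; have -> : d = - c by [lia]; ring.
Qed.

(** The boundary of the restriction at [w] is that of [c] if [X w] holds and zero otherwise, because
    nothing flows across the cut. *)
Lemma restrict_cycle (G : graph) (X : pred 'I_(nv G)) (c : 'rV[int]_(ne G)) : is_cycle c ->
  (forall e, e \in cut X -> c 0 e = 0) ->
  is_cycle (\row_e if X (src e) then c 0 e else 0).
Proof.
move=> cyc c0; apply/rowP => w; rewrite [RHS]mxE.
transitivity ((X w)%:R * (c *m bdry G) 0 w); last by rewrite cyc mxE mulr0.
rewrite [in RHS]mxE mulr_sumr [LHS]mxE; apply: eq_bigr => e _; rewrite mxE bdryE.
have [ce|] := boolP (e \in cut X); first by rewrite c0 // if_same !mul0r mulr0.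
rewrite inE negbK => /eqP Xe.
have [tw|tw] := eqVneq (tgt e) w; first by rewrite Xe tw; case: (X w); rewrite ?mul1r ?mul0r.
have [sw|sw] := eqVneq (src e) w; first by rewrite sw; case: (X w); rewrite ?mul1r ?mul0r.
by rewrite subrr !mulr0.
Qed.

Definition cubic_3connected g (G : graph) (B : 'M[int]_(g, ne G)) : Prop :=
  [/\ graph_connected G, three_regular G, (1 < nv G)%N, H1_basis B & simple_basis B].

(** The cut around [v] is the star without its loops and has at least three edges, whereas a loop
    would use up two of the three half-edges. *)
Lemma star_cubic g (G : graph) (B : 'M[int]_(g, ne G)) (v : 'I_(nv G)) : cubic_3connected B ->
  [set e | (src e == v) && (tgt e == v)]%SET = finset.set0 /\ #|star v| = 3%N.
Proof.
move=> [conn reg nv1 basB simB].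
have [w wv] : exists w, w != v.
  have [v0|v0] := eqVneq (v : nat) 0%N.
    by exists (Ordinal nv1); rewrite -val_eqE /= v0.
  by exists (Ordinal (ltnW nv1)); rewrite -val_eqE /= eq_sym.
have := cut_ge3 (X := pred1 v) conn basB simB (eqxx v) wv.
pose S : {set 'I_(ne G)} := [set e | src e == v]%SET.
pose T : {set 'I_(ne G)} := [set e | tgt e == v]%SET.
have starE : star v = S :|: T by apply/setP => e; rewrite !inE.
have loopE : [set e | (src e == v) && (tgt e == v)]%SET = S :&: T by apply/setP => e; rewrite !inE.
have -> : cut (pred1 v) = star v :\: (S :&: T).
  by apply/setP => e; rewrite !inE /=; case: (src e == v) (tgt e == v) => [] [].
have val3 : (#|S| + #|T|)%N = 3%N.
  by rewrite -(reg v); congr (_ + _)%N; apply: eq_card => e; rewrite inE.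
move: val3; rewrite -cardsUI -starE cardsD.
have -> : star v :&: (S :&: T) = S :&: T.
  by apply/setP => e; rewrite !inE; case: (src e == v) (tgt e == v) => [] [].
rewrite loopE => cE c3.
suff [st lp] : #|star v| = 3%N /\ #|S :&: T| = 0%N.
  by split=> //; apply/eqP; rewrite -cards_eq0 lp.
by move: cE c3; move: (#|star v|) (#|_|) => m n; lia.
Qed.

Lemma loopless g (G : graph) (B : 'M[int]_(g, ne G)) (e : 'I_(ne G)) : cubic_3connected B -> src e != tgt e.
Proof.
move/(star_cubic (src e)) => [/setP/(_ e)]; rewrite !inE eqxx /= eq_sym => h _.
by rewrite h.
Qed.

Lemma star_src (G : graph) (e : 'I_(ne G)) : e \in star (src e).
Proof. by rewrite inE eqxx. Qed.

Lemma star_tgt (G : graph) (e : 'I_(ne G)) : e \in star (tgt e).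
Proof. by rewrite inE eqxx orbT. Qed.

(* In a cubic 3-edge-connected graph, removing a vertex leaves no bridge. *)
Lemma cycle_avoiding_vertex g (G : graph) (B : 'M[int]_(g, ne G)) v a :
  cubic_3connected B -> a \notin star v ->
  exists c : 'rV[int]_(ne G),
    [/\ is_cycle c, forall e, e \in star v -> c 0 e = 0 & c 0 a != 0].
Proof.
move=> cub av; have [conn _ _ basB simB] := cub.
have [//|no] := pselect (exists c : 'rV[int]_(ne G),
  [/\ is_cycle c, forall e, e \in star v -> c 0 e = 0 & c 0 a != 0]).
pose D : 'rV[int]_(ne G) := \row_e (e \in star v)%:R.
(* If no such cycle exists, the coefficient at [a] vanishes on all cycles avoiding the star; the
   diagonal block imposes the avoidance. Duality yields a potential that, off the star, jumps only
   along [a]. *)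
have [|q qE] := @int_dual _ _ (row_mx (bdry G) (diag_mx D)) (delta_mx a 0).
  move=> c; rewrite mul_mx_row => cA.
  have [cyc cD] : c *m bdry G = 0 /\ c *m diag_mx D = 0.
    by apply: eq_row_mx; rewrite cA row_mx0.
  rewrite -colE; apply/rowP => i; rewrite ord1 !mxE; apply/eqP; apply: contraT => ca.
  case: no; exists c; split=> // e eD; move/rowP/(_ e): cD.
  by rewrite mul_mx_diag !mxE eD mulr1.
rewrite map_row_mx -(vsubmxK q) mul_row_col in qE.
pose p w := usubmx q w 0.
have pE e : e \notin star v -> p (tgt e) - p (src e) = (e == a)%:R.
  move=> ev; move/colP/(_ e): qE; rewrite [in RHS]mxE bdry_mul_col -/p.
  rewrite map_diag_mx mul_diag_mx !mxE (negPf ev) mul0r addr0 eqxx andbT /p !mxE => <-.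
  by case: (e == a).
(* The level sets of the two ends of [a], without [v]. Each has a cut of at least three edges, all
   but [a] in the star of [v]; the two shares are disjoint, which would require four edges in the
   star. *)
pose X b := [pred w | (w != v) && (p w == p (if b then src a else tgt a))].
have avs : src a != v by apply: contraNneq av => <-; apply: star_src.
have avt : tgt a != v by apply: contraNneq av => <-; apply: star_tgt.
have X3 b : (3 <= #|cut (X b)|)%N.
  apply: (@cut_ge3 _ _ _ _ (if b then src a else tgt a) v conn basB simB).
    by rewrite /= eqxx andbT; case: b.
  by rewrite /= eqxx.
have cutX b : cut (X b) \subset a |: (cut (X b) :&: star v).
  apply/fintype.subsetP => e eX; rewrite !inE; case: eqVneq => //= ea.
  have [ev|ev] := boolP (e \in star v); first by rewrite inE in eX; rewrite eX; rewrite inE in ev.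
  have := pE e ev; rewrite (negPf ea) => /eqP; rewrite subr_eq0 => /eqP pe.
  move: eX; rewrite !inE /= pe.
  have es : src e != v by apply: contraNneq ev => <-; apply: star_src.
  have et : tgt e != v by apply: contraNneq ev => <-; apply: star_tgt.
  by rewrite es et eqxx.
have disj : [disjoint cut (X true) :&: star v & cut (X false) :&: star v].
  rewrite -setI_eq0; apply/eqP/setP => e; rewrite finset.in_set0; apply/negP.
  rewrite 2!inE [e \in star v]inE [e \in cut _]inE [e \in _ :&: _]inE [e \in cut _]inE.
  move=> /andP[/andP[X1 ev] /andP[X2 _]]; have := pE a av; rewrite eqxx.
  move=> pa; have Xv b : X b v = false by rewrite /= eqxx.
  have key x : X true x && X false x = false.
    apply/negP => /= /andP[/andP[_ /eqP ->] /andP[_ /eqP ps]].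
    by move: pa; rewrite ps subrr => /eqP; rewrite eq_sym oner_eq0.
  move: X1 X2 (key (src e)) (key (tgt e)).
  by case/orP: ev => /eqP ->; rewrite !Xv; do 2 case: (X _ _).
exfalso.
have le b : (#|cut (X b)| <= 1 + #|cut (X b) :&: star v|)%N.
  by apply: leq_trans (subset_leq_card (cutX b)) _; rewrite cardsU1 leq_add2r leq_b1.
have : (#|cut (X true) :&: star v| + #|cut (X false) :&: star v| <= 3)%N.
  rewrite -(star_cubic v cub).2 -cardsUI.
  have -> : (cut (X true) :&: star v) :&: (cut (X false) :&: star v) = finset.set0.
    by apply/eqP; rewrite setI_eq0.
  by rewrite cards0 addn0 subset_leq_card // finset.subUset !finset.subsetIr.
by move: (X3 true) (X3 false) (le true) (le false); lia.
Qed.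

(* The cycle matroid of a cubic 3-edge-connected graph minus a vertex is connected. *)
Lemma star_nonseparating g (G : graph) (B : 'M[int]_(g, ne G)) v (P : pred 'I_(ne G)) :
  cubic_3connected B ->
  (forall c : 'rV[int]_(ne G), is_cycle c -> (forall e, e \in star v -> c 0 e = 0) ->
     is_cycle (\row_e if P e then c 0 e else 0)) ->
  (forall e, e \notin star v -> P e) \/ (forall e, e \notin star v -> ~~ P e).
Proof.
move=> cub; have [conn _ _ basB simB] := cub; move: P.
(* A cycle through [e] off the star of [v] cannot stay a cycle after restriction to [P]: only [e]
   would carry flow at [w]. *)
have lone (P : pred 'I_(ne G)) (w : 'I_(nv G)) e : w != v -> e \in star w -> e \notin star v -> P e ->
    (forall k, k \in star w -> k != e -> k \notin star v -> ~~ P k) ->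
    ~ (forall c : 'rV[int]_(ne G), is_cycle c -> (forall e, e \in star v -> c 0 e = 0) ->
        is_cycle (\row_e if P e then c 0 e else 0)).
  move=> wv ew ev Pe nPk sep.
  have [c [cyc cv ce]] := cycle_avoiding_vertex cub ev.
  have := cycle_potential (fun u => (u == w)%:R) (sep c cyc cv).
  rewrite (bigD1 e) //= big1 => [|k ke].
    rewrite mxE Pe addr0; move: ew (loopless e cub); rewrite inE.
    case: (eqVneq (src e) w) => [sw|sw]; case: (eqVneq (tgt e) w) => [tw|tw] //= _.
    + by rewrite sw tw eqxx.
    + by move=> _; move: (c 0 e) ce => a; lia.
    + by move=> _; move: (c 0 e) ce => a; lia.
  rewrite mxE; have [kw|] := boolP (k \in star w).
    have [kv|kv] := boolP (k \in star v); first by rewrite cv // if_same mul0r.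
    by rewrite (negPf (nPk k kw ke kv)) mul0r.
  by rewrite inE negb_or => /andP[/negPf-> /negPf->]; rewrite subrr mulr0.
move=> P sep.
have sep' (c : 'rV[int]_(ne G)) : is_cycle c -> (forall e, e \in star v -> c 0 e = 0) ->
    is_cycle (\row_e if ~~ P e then c 0 e else 0).
  move=> cyc cv; have -> : \row_e (if ~~ P e then c 0 e else 0) = c - \row_e if P e then c 0 e else 0.
    by apply/rowP => e; rewrite !mxE; case: (P e); rewrite ?subrr ?subr0.
  by rewrite /is_cycle mulmxBl cyc (sep c cyc cv) subrr.
(* If the edges at [w] off the star were split between [P] and its complement, one class would
   consist of a lone edge. *)
have same w e f : w != v -> e \in star w -> f \in star w -> e \notin star v -> f \notin star v ->
    P e -> P f.
  move=> wv ew fw ev fv Pe; apply: contraT => Pf.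
  have ef : e != f by apply: contraNneq Pf => <-.
  have [/existsP[k /and4P[kw ke kv Pk]]|] :=
    boolP [exists k, [&& k \in star w, k != e, k \notin star v & P k]].
    have kf : k != f by apply: contraNneq Pf => <-.
    exfalso; apply: (lone (fun e => ~~ P e) w f) => // k' k'w k'f k'v; rewrite negbK.
    have : k' \in [set e; f; k]%SET.
      have /eqP -> // : [set e; f; k]%SET == star w.
      rewrite eqEcard (star_cubic w cub).2 !finset.subUset !finset.sub1set ew fw kw.
      by rewrite finset.setUC cardsU1 cards2 !inE negb_or ke kf ef.
    by rewrite !inE (negPf k'f) => /orP[/orP[/eqP->|//]|/eqP->].
  rewrite negb_exists => /forallP nk; exfalso.
  apply: (lone P w e) => // k kw ke kv.
  by have := nk k; rewrite kw ke kv.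
have [allP|] := boolP [forall e, (e \notin star v) ==> P e].
  by left=> e; move/forallP/(_ e)/implyP: allP.
rewrite negb_forall => /existsP[b]; rewrite negb_imply => /andP[bv Pb].
right=> a av; apply/negP => Pa.
(* The vertices other than [v] split according to the class of their edges. Both parts have cuts of
   at least three edges inside the star of [v], and these cuts are disjoint, against the valence
   3. *)
pose VA w := (w != v) && [exists e, [&& e \in star w, e \notin star v & P e]].
pose VB w := (w != v) && ~~ VA w.
have ends e : e \notin star v -> src e != v /\ tgt e != v.
  by rewrite inE negb_or => /andP[].
have VAE w e : w != v -> e \in star w -> e \notin star v -> VA w = P e.
  move=> wv ew ev; apply/idP/idP => [/andP[_ /existsP[f /and3P[fw fv Pf]]]|Pe].
    exact: (same w f e).
  by rewrite /VA wv; apply/existsP; exists e; rewrite ew ev.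
have VA3 : (3 <= #|cut VA|)%N.
  apply: (@cut_ge3 _ _ _ _ (src a) v conn basB simB); last by rewrite /VA eqxx.
  by rewrite (VAE _ a) ?star_src //; case: (ends a av).
have VB3 : (3 <= #|cut VB|)%N.
  apply: (@cut_ge3 _ _ _ _ (src b) v conn basB simB); last by rewrite /VB eqxx.
  have [bs _] := ends b bv.
  by rewrite /VB bs (VAE _ b) ?star_src.
have cutA : cut VA \subset star v.
  apply/fintype.subsetP => e; rewrite inE; apply: contraR => ev; have [es et] := ends e ev.
  by rewrite (VAE _ e es (star_src e) ev) (VAE _ e et (star_tgt e) ev).
have cutB : cut VB \subset star v.
  apply/fintype.subsetP => e; rewrite inE; apply: contraR => ev; have [es et] := ends e ev.
  by rewrite /VB es et (VAE _ e es (star_src e) ev) (VAE _ e et (star_tgt e) ev).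
have disj : cut VA :&: cut VB = finset.set0.
  apply/setP => e; rewrite finset.in_set0; apply/negP; rewrite inE => /andP[eA eB].
  have ev := fintype.subsetP cutA e eA; move: eA eB; rewrite 2!inE /VB.
  have VAv : VA v = false by rewrite /VA eqxx.
  have lo := loopless e cub; move: ev; rewrite inE => /orP[]/eqP ev.
    by move: lo; rewrite ev VAv eqxx /= eq_sym => -> /=; case: (VA _).
  by move: lo; rewrite ev VAv eqxx /= => -> /=; case: (VA _).
have := subset_leq_card (_ : cut VA :|: cut VB \subset star v).
rewrite finset.subUset cutA cutB => /(_ isT).
have := cardsUI (cut VA) (cut VB); rewrite disj cards0 (star_cubic v cub).2.
by move: VA3 VB3; move: (#|_|) (#|_|) (#|_|) => m n k; lia.
Qed.

Definition edge_match g (G G' : graph) (B : 'M[int]_(g, ne G)) (B' : 'M[int]_(g, ne G'))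
    (h : 'I_(ne G) -> 'I_(ne G')) : Prop :=
  bijective h /\ forall e, col (h e) B' = col e B \/ col (h e) B' = - col e B.

(** The boundary coefficient at [v] vanishes on cycles, so it comes from a potential on [G'], a
    level set of which has cut exactly [h @: star v]. By [star_nonseparating] all other edges lie on
    one side of this cut, so the other side holds a vertex with exactly this star. *)
Lemma edge_match_star g (G G' : graph) (B : 'M[int]_(g, ne G)) (B' : 'M[int]_(g, ne G')) h v :
  cubic_3connected B -> cubic_3connected B' -> edge_match B B' h ->
  exists v', star v' = h @: star v.
Proof.
move=> cub cub' [[k hk kh] pm]; have [_ _ _ basB simB] := cub.
have [conn' _ _ basB' simB'] := cub'.
pose s e : int := if col (h e) B' == col e B then 1 else -1.
have s2 e : s e * s e = 1 by rewrite /s; case: ifP.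
have colE (a : 'rV[int]_g) e : (a *m B') 0 (h e) = s e * (a *m B) 0 e.
  rewrite -(mul_col_entry a B') -(mul_col_entry a B) /s; case: eqP => [->|ne]; first by rewrite mul1r.
  by case: (pm e) => // ->; rewrite mulmxN mxE mulN1r.
have [|q qE] := @int_dual _ _ (bdry G') (\col_e' (s (k e') * bdry G (k e') v)).
  move=> c' /(H1_basis_coord basB')[a ->]; apply/rowP => i; rewrite ord1 [RHS]mxE.
  transitivity ((a *m B *m bdry G) 0 v); last by rewrite (H1_basis_cycle a basB) mxE.
  rewrite [LHS]mxE [RHS]mxE.
  rewrite (reindex h) /=; last by exists k => e _; rewrite ?hk ?kh.
  apply: eq_bigr => e _; rewrite colE [X in _ * X = _]mxE hk.
  by have := s2 e; move: (s e) ((a *m B) 0 e) (bdry G e v) => x y z xx; rewrite mulrACA xx mul1r.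
have qh e : q (tgt (h e)) 0 - q (src (h e)) 0 = (s e * bdry G e v)%:~R.
  by rewrite -bdry_mul_col -qE !mxE hk.
have hstar e : e \notin star v -> q (tgt (h e)) 0 = q (src (h e)) 0.
  rewrite inE negb_or => /andP[/negPf sv /negPf tv]; apply/eqP.
  by rewrite -subr_eq0 qh bdryE sv tv subrr mulr0.
have [d dv] : exists d, d \in star v.
  by apply/set0Pn; rewrite -cards_eq0 (star_cubic v cub).2.
have qd : q (tgt (h d)) 0 != q (src (h d)) 0.
  rewrite -subr_eq0 qh intr_eq0 bdryE mulf_neq0 //; first by rewrite /s; case: ifP.
  move: dv (loopless d cub); rewrite inE.
  case: (eqVneq (src d) v) => [sv|sv]; case: (eqVneq (tgt d) v) => [tv|tv] //=.
  by rewrite sv tv eqxx.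
pose X : pred 'I_(nv G') := fun w => q w 0 == q (src (h d)) 0.
have Xs : X (src (h d)) by rewrite /X.
have Xt : ~~ X (tgt (h d)) by [].
have cutX : cut X = h @: star v.
  apply/eqP; rewrite eqEcard card_imset ?(star_cubic v cub).2; last exact: can_inj hk.
  rewrite (cut_ge3 conn' basB' simB' Xs Xt) andbT; apply/fintype.subsetP => e'.
  rewrite -(kh e') (mem_imset _ _ (can_inj hk)) inE; apply: contraR => /hstar.
  by rewrite /X => ->.
have cutXh e : (h e \in cut X) = (e \in star v).
  by rewrite cutX (mem_imset _ _ (can_inj hk)).
have star3 v' : (forall e, h e \in star v' -> e \in star v) -> star v' = h @: star v.
  move=> sub; apply/eqP; rewrite eqEcard card_imset ?(star_cubic v cub).2; last exact: can_inj hk.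
  rewrite (star_cubic v' cub').2 leqnn andbT; apply/fintype.subsetP => e'.
  by rewrite -(kh e') (mem_imset _ _ (can_inj hk)); apply: sub.
have Xends e : e \notin star v -> X (src (h e)) = X (tgt (h e)).
  by move/hstar; rewrite /X => ->.
have [|inX|notX] := @star_nonseparating _ _ _ v (fun e => X (src (h e))) cub.
- move=> c /(H1_basis_coord basB)[a ->] cv.
  have := restrict_cycle (X := X) (H1_basis_cycle a basB').
  case/(_ _)/(H1_basis_coord basB') => [e'|b bE].
    rewrite -(kh e') cutXh colE => /cv ->; by rewrite mulr0.
  suff -> : \row_e (if X (src (h e)) then (a *m B) 0 e else 0) = b *m B by apply: H1_basis_cycle.
  apply/rowP => e; rewrite mxE -[RHS]mul1r -(s2 e) -mulrA -colE -bE [X in _ = _ * X]mxE colE.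
  by case: ifP; rewrite ?mulr0 // mulrA s2 mul1r.
- exists (tgt (h d)); apply: star3 => e; rewrite inE => /orP[]/eqP eE; apply: contraT => ev.
    by move: Xt; rewrite -eE inX.
  by move: Xt; rewrite -eE -Xends ?inX.
- exists (src (h d)); apply: star3 => e; rewrite inE => /orP[]/eqP eE; apply: contraT => ev.
    by move: Xs; rewrite -eE (negPf (notX e ev)).
  by move: Xs; rewrite -eE -Xends ?(negPf (notX e ev)).
Qed.

(** With two vertices both stars are the whole edge set, and every edge joins the two vertices. With
    more, equal stars of [u] and [w] would make the cut around both empty although a third vertex
    exists; stars then determine the vertex map. *)
Lemma edge_match_joins g (G G' : graph) (B : 'M[int]_(g, ne G)) (B' : 'M[int]_(g, ne G')) h :
  cubic_3connected B -> cubic_3connected B' -> edge_match B B' h -> nv G = nv G' ->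
  exists2 f : 'I_(nv G) -> 'I_(nv G'), bijective f &
    forall e, joins (h e) (f (src e)) (f (tgt e)).
Proof.
move=> cub cub' match_h nvE; have [conn _ nv1 basB simB] := cub.
have [nv2|nv2] := leqP (nv G) 2.
  exists (cast_ord nvE).
    by exists (cast_ord (esym nvE)); [apply: cast_ordK | apply: cast_ordKV].
  move=> e; have := loopless e cub; have := loopless (h e) cub'; rewrite /joins -!val_eqE /=.
  have lt2 (w : 'I_(nv G)) : (w < 2)%N by apply: leq_trans (ltn_ord w) nv2.
  have lt2' (w : 'I_(nv G')) : (w < 2)%N by apply: leq_trans (ltn_ord w) _; rewrite -nvE.
  move: (lt2 (src e)) (lt2 (tgt e)) (lt2' (src (h e))) (lt2' (tgt (h e))).
  by move: (src e : nat) (tgt e : nat) (src (h e) : nat) (tgt (h e) : nat) => a b c d; lia.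
have /fin_all_exists[f fP] : forall v, exists v', star v' = h @: star v.
  by move=> v; apply: edge_match_star match_h.
have [[k hk kh] _] := match_h.
have hI := imset_inj (can_inj hk).
have f_inj : injective f.
  move=> u w fuw; apply/eqP; apply: contraT => uw.
  have suw : star u = star w by apply: hI; rewrite -!fP fuw.
  have [x /andP[xu xw]] : exists x, (x != u) && (x != w).
    apply/existsP; apply: contraT; rewrite negb_exists => /forallP nx.
    have : (#|[set: 'I_(nv G)]%SET| <= #|[set u; w]%SET|)%N.
      apply: subset_leq_card; apply/fintype.subsetP => x _; rewrite !inE.
      by have := nx x; rewrite negb_and !negbK.
    by rewrite cardsT card_ord cards2; lia.
  have := cut_ge3 (X := fun y => (y == u) || (y == w)) conn basB simB (_ : (u == u) || (u == w)).
  move=> /(_ x); rewrite eqxx (negPf xu) (negPf xw) => /(_ isT isT).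
  have -> : cut (fun y => (y == u) || (y == w)) = finset.set0; last by rewrite cards0.
  apply/setP => e; rewrite finset.in_set0 inE; apply: negbTE; rewrite negbK.
  have := congr1 (fun S : {set 'I_(ne G)} => e \in S) suw; rewrite /= !inE.
  have lo y : ~~ ((src e == y) && (tgt e == y)).
    by apply: contra (loopless e cub) => /andP[/eqP-> /eqP->].
  have ne y : ~~ ((y == u) && (y == w)) by apply: contra uw => /andP[/eqP<- /eqP<-].
  move: (lo u) (lo w) (ne (src e)) (ne (tgt e)).
  by case: (src e == u); case: (tgt e == u); case: (src e == w); case: (tgt e == w).
exists f; first by apply: inj_card_bij => //; rewrite !card_ord nvE.
move=> e; have lo := loopless e cub.
have hs : h e \in star (f (src e)) by rewrite fP imset_f ?star_src.
have ht : h e \in star (f (tgt e)) by rewrite fP imset_f ?star_tgt.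
have fst : f (src e) != f (tgt e) by rewrite (inj_eq f_inj).
move: hs ht; rewrite !inE /joins; case/orP=> /eqP->; case/orP => /eqP tE.
- by move: fst; rewrite tE eqxx.
- by rewrite tE !eqxx.
- by rewrite tE !eqxx orbT.
- by move: fst; rewrite tE eqxx.
Qed.

(** * Whitehead moves *)

Lemma map_mx_intz m n (A : 'M[int]_(m, n)) : map_mx intr A = A.
Proof. by apply/matrixP => i j; rewrite mxE intz. Qed.

(** All three properties are read off the kernels of the boundary matrix; multiplying by [T] on the
    left keeps the right kernel and moves the left one by the inverse of [T]. *)
Lemma bdry_change (G : graph) (src' tgt' : 'I_(ne G) -> 'I_(nv G)) (T : 'M[int]_(ne G)) :
  T \in unitmx -> bdry (Graph src' tgt') = T *m bdry G ->
  [/\ graph_connected G -> graph_connected (Graph src' tgt'),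
      betti1 (Graph src' tgt') = betti1 G
    & forall g (B : 'M[int]_(g, ne G)), H1_basis B ->
        @H1_basis g (Graph src' tgt') (B *m invmx T)].
Proof.
set G' := Graph _ _ => Tu bE; split.
- move=> conn; apply: const_connected; first by case: conn.
  move=> p pe; apply: (connected_const conn) => e.
  pose q : 'cV[int]_(nv G) := \col_v (p v)%:R.
  have q0 : bdry G' *m q = 0.
    apply/colP => e'; have := @bdry_mul_col int G' q e'; rewrite map_mx_intz => ->.
    by rewrite ![q _ _]mxE pe subrr mxE.
  have := @bdry_mul_col int G q e; rewrite map_mx_intz -[bdry G](mulKmx Tu) -bE.
  by rewrite -mulmxA q0 mulmx0 !mxE; case: (p (src e)); case: (p (tgt e)).
- rewrite /betti1 bE map_mxM !mxrank_ker; congr (_ - _)%N.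
  rewrite eqmxMfull // row_full_unit unitmxE det_map_mx.
  by apply: rmorph_unit; rewrite -unitmxE.
- move=> g B basB; split.
    rewrite bE mulmxA mulmxKV //; exact: basB.1.
  move=> c; rewrite bE mulmxA => /(H1_basis_coord basB)[a aE].
  exists a; split; first by rewrite mulmxA -aE mulmxK.
  by move=> b cE; apply: (H1_basis_inj basB); rewrite -aE cE mulmxA mulmxKV.
Qed.

Definition half_sign (b : bool) : int := if b then 1 else -1.

Lemma bdry_half (G : graph) e v :
  bdry G e v = \sum_b half_sign b * (half_end (e, b) == v)%:R.
Proof. by rewrite bdryE big_bool /= mul1r mulN1r. Qed.

Definition swap_ends (G : graph) (x y : 'I_(ne G) * bool) : graph :=
  Graph (fun e => half_end (tperm x y (e, false))) (fun e => half_end (tperm x y (e, true))).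

Lemma half_end_swap (G : graph) (x y z : 'I_(ne G) * bool) :
  @half_end (swap_ends x y) z = half_end (tperm x y z).
Proof. by case: z => e []. Qed.

Lemma valence_swap (G : graph) (x y : 'I_(ne G) * bool) v :
  @valence (swap_ends x y) v = @valence G v.
Proof.
rewrite !valenceE -[RHS](card_imset _ (@perm_inj _ (tperm x y))).
apply: eq_card => z; rewrite -[in RHS](tpermK x y z) (mem_imset _ _ (@perm_inj _ _)).
by rewrite !inE half_end_swap.
Qed.

(* The Whitehead move at e: swap a half-edge x at the source of e with a half-edge
   y at its target. *)
Lemma whitehead_move g (G : graph) (B : 'M[int]_(g, ne G)) (e : 'I_(ne G))
    (x y : 'I_(ne G) * bool) :
  stable_graph g G -> three_regular G -> H1_basis B -> src e != tgt e ->
  half_end x = src e -> half_end y = tgt e -> x.1 != e -> y.1 != e ->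
  exists (src' tgt' : 'I_(ne G) -> 'I_(nv G)) (B' : 'M[int]_(g, ne G)),
    [/\ stable_graph g (Graph src' tgt'), three_regular (Graph src' tgt'),
        @H1_basis g (Graph src' tgt') B', forall k, k != e -> col k B' = col k B
      & col e B' =
        col e B - half_sign x.2 *: col x.1 B + half_sign y.2 *: col y.1 B].
Proof.
move=> [conn bet val3] reg basB st xs yt xe ye.
have xy : x != y by apply: contra st => /eqP xy; rewrite -xs -yt xy.
(* Moving the half-edge [x] along [e] adds the boundary of [e], up to the sign of [x], to that of
   [x.1]; moving [y] the other way subtracts it, up to the sign of [y]. *)
pose gam : 'cV[int]_(ne G) :=
  half_sign x.2 *: delta_mx x.1 0 - half_sign y.2 *: delta_mx y.1 0.
pose D : 'M[int]_(ne G) := gam *m delta_mx 0 e.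
(* Neither half-edge belongs to [e], so the change is nilpotent and [1 - D] inverts [1 + D]; only
   the column of [e] is affected. *)
have DD : D *m D = 0.
  rewrite /D mulmxA -(mulmxA gam) -rowE.
  have -> : row e gam = 0.
    by apply/rowP => i; rewrite !mxE !(eq_sym e) (negPf xe) (negPf ye) /= !mulr0 subrr.
  by rewrite mulmx0 mul0mx.
have TT : (1%:M + D) *m (1%:M - D) = 1%:M.
  by rewrite mulmxDl !mulmxBr !mulmx1 mul1mx DD subr0 subrK.
have [Tu Ti] := mulmx1_unit TT.
have bE : bdry (swap_ends x y) = (1%:M + D) *m bdry G.
  apply/matrixP => k v; rewrite mulmxDl mul1mx /D -mulmxA -rowE [RHS]mxE [X in _ + X]mxE big_ord1.
  rewrite [row e _ _ _]mxE.
  pose F z : int := (@half_end G z == v)%:R.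
  have FE z : F (tperm x y z) = F z + ((z == x)%:R - (z == y)%:R) * bdry G e v.
    rewrite bdryE -xs -yt -/(F x) -/(F y).
    case: tpermP => [->|->|/eqP/negPf-> /eqP/negPf->].
    - by rewrite eqxx (negPf xy) /=; ring.
    - by rewrite eqxx eq_sym (negPf xy) /=; ring.
    - by rewrite subrr mul0r addr0.
  have gamE : gam k 0 = \sum_b half_sign b * (((k, b) == x)%:R - ((k, b) == y)%:R).
    rewrite big_bool !mxE; case: (x) (y) => [h1 s1] [h2 s2]; rewrite !xpair_eqE /= ?eqxx ?andbT.
    by case: s1; case: s2; rewrite /half_sign /= ?andbT ?andbF; case: (k == h1); case: (k == h2).
  rewrite gamE !bdry_half mulr_suml -big_split; apply: eq_bigr => b _ /=.
  by rewrite half_end_swap -/(F _) -/(F (k, b)) FE -bdry_half; ring.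
have [conn' bet' bas'] := bdry_change Tu bE.
exists (@src (swap_ends x y)), (@tgt (swap_ends x y)), (B *m invmx (1%:M + D)); split.
- split; [exact: conn' | by rewrite bet' | by move=> v; rewrite valence_swap].
- by move=> v; rewrite valence_swap.
- exact: bas'.
- have invE : invmx (1%:M + D) = 1%:M - D by apply: (can_inj (mulKmx Tu)); rewrite mulmxV // TT.
  move=> k ke; apply/colP => i; rewrite invE mulmxBr mulmx1 /D mulmxA !mxE.
  by rewrite big_ord1 !mxE (negPf ke) andbF mulr0 subr0.
- have invE : invmx (1%:M + D) = 1%:M - D by apply: (can_inj (mulKmx Tu)); rewrite mulmxV // TT.
  apply/colP => i; rewrite invE mulmxBr mulmx1 /D mulmxA.
  have gamE : (B *m gam) i 0 = half_sign x.2 * B i x.1 - half_sign y.2 * B i y.1.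
    by rewrite /gam mulmxBr -!scalemxAr -!colE !mxE.
  rewrite [LHS]mxE [LHS]mxE [X in _ + X = _]mxE [X in _ - X = _]mxE big_ord1 gamE !mxE !eqxx.
  by have -> : (true && true)%:R = 1 :> int by []; ring.
Qed.

Lemma cubic_vertex (G : graph) (x : 'I_(ne G) * bool) : three_regular G ->
  exists y z : 'I_(ne G) * bool,
    [/\ y != x, half_end y = half_end x, half_end z = half_end x
      & forall F : 'I_(ne G) * bool -> int,
          \sum_(w | half_end w == half_end x) F w = F x + F y + F z].
Proof.
move=> reg; pose S : {set 'I_(ne G) * bool} := [set w | half_end w == half_end x].
have xS : x \in S by rewrite inE.
have S3 : #|S| = 3%N by rewrite cardsE -valenceE reg.
have /cards2P[y [z [yz SE]]] : #|S :\ x| == 2%N by apply/eqP; have := cardsD1 x S; rewrite xS S3 add1n => -[].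
have : y \in S :\ x by rewrite SE !inE eqxx.
have : z \in S :\ x by rewrite SE !inE eqxx orbT.
rewrite !inE => /andP[zx /eqP zE] /andP[yx /eqP yE].
exists y, z; split=> // F; rewrite -addrA.
transitivity (\sum_(w in S) F w); first by apply: eq_bigl => w; rewrite inE.
by rewrite (big_setD1 x) //= SE big_setU1 ?big_set1 // inE.
Qed.

Lemma cycle_at_vertex (G : graph) (c : 'rV[int]_(ne G)) v : is_cycle c ->
  \sum_(w | half_end w == v) half_sign w.2 * c 0 w.1 = 0.
Proof.
move=> cyc; transitivity ((c *m bdry G) 0 v); last by rewrite cyc mxE.
rewrite [RHS]mxE.
pose F e b := if half_end (e, b) == v then half_sign b * c 0 e else 0.
transitivity (\sum_e \sum_b F e b).
  by rewrite [LHS]big_mkcond pair_bigA; apply: eq_bigr => -[].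
apply: eq_bigr => e _; rewrite bdry_half mulr_sumr; apply: eq_bigr => b _ /=.
by rewrite /F; case: eqP => _; rewrite ?mulr1 ?mulr0 // mulrC.
Qed.

Lemma loop_cycle (G : graph) (e : 'I_(ne G)) : src e = tgt e ->
  is_cycle (delta_mx 0 e : 'rV[int]_(ne G)).
Proof. by move=> ste; rewrite /is_cycle -rowE; apply/rowP => v; rewrite !mxE ste subrr. Qed.

Lemma int_potential (G : graph) (w : 'cV[int]_(ne G)) :
  (forall c : 'rV[int]_(ne G), is_cycle c -> c *m w = 0) ->
  exists q : 'I_(nv G) -> rat, forall e, q (tgt e) - q (src e) = (w e 0)%:~R.
Proof.
move/int_dual => [q qE]; exists (fun v => q v 0) => e.
by rewrite -bdry_mul_col -qE mxE.
Qed.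

(** The potential is constant along every edge but [e] and [f], so the cut of a level set contains
    at most these two, where [c] vanishes. *)
Lemma level_cycle (G : graph) (q : 'I_(nv G) -> rat) (e f : 'I_(ne G)) (c : 'rV[int]_(ne G)) r :
  (forall k, k != e -> k != f -> q (src k) = q (tgt k)) -> is_cycle c ->
  c 0 e = 0 -> c 0 f = 0 -> is_cycle (\row_k if q (src k) == r then c 0 k else 0).
Proof.
move=> qk cyc ce cf; apply: (restrict_cycle (X := fun v => q v == r) cyc) => k.
rewrite inE; have [->//|ke] := eqVneq k e; have [->//|kf] := eqVneq k f.
by rewrite qk ?eqxx.
Qed.

(** Under this condition a Gram matrix obtained from [B] also comes from [B'] once lengths may be
    zero. *)
Definition refines g m n (B : 'M[int]_(g, m)) (B' : 'M[int]_(g, n)) : Prop :=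
  forall k, col k B = 0 \/ exists k', col k' B' = col k B \/ col k' B' = - col k B.

Lemma refines_trans g m n p (A : 'M[int]_(g, m)) (B : 'M[int]_(g, n)) (C : 'M[int]_(g, p)) :
  refines A B -> refines B C -> refines A C.
Proof.
move=> AB BC k; have [->|[j jE]] := AB k; first by left.
have [j0|[i iE]] := BC j.
  by left; case: jE => /esym; rewrite j0 => // /eqP; rewrite oppr_eq0 => /eqP.
by right; exists i; case: iE => ->; case: jE => ->; rewrite ?opprK; [left|right|right|left].
Qed.

Lemma col_eq0P g (G : graph) (B : 'M[int]_(g, ne G)) e : H1_basis B -> col e B = 0 ->
  forall c : 'rV[int]_(ne G), is_cycle c -> c 0 e = 0.
Proof.
by move=> basB e0 c /(H1_basis_coord basB)[a ->]; rewrite -mul_col_entry e0 mulmx0 mxE.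
Qed.

Lemma row_cycle g (G : graph) (B : 'M[int]_(g, ne G)) i : H1_basis B -> is_cycle (row i B).
Proof. by move=> basB; rewrite rowE; apply: H1_basis_cycle. Qed.

(** Some bridge meets an edge that is not a bridge, since the graph is connected and has cycles.
    After a Whitehead move there, the new functional is detected by a cycle on one side of the
    bridge. *)
Lemma bridge_removal g (G : graph) (B : 'M[int]_(g, ne G)) :
  (0 < g)%N -> stable_graph g G -> three_regular G -> H1_basis B ->
  (exists e, col e B = 0) ->
  exists (G' : graph) (B' : 'M[int]_(g, ne G')),
    [/\ stable_graph g G', three_regular G', H1_basis B', refines B B'
      & (#|[pred k | col k B' == 0%R]| < #|[pred k | col k B == 0%R]|)%N].
Proof.
move=> g0 st reg basB [e0 e00]; have [conn _ _] := st.
have [k0 k00] : exists k, col k B != 0.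
  apply/existsP; apply: contraT; rewrite negb_exists => /forallP B0.
  have [C BC] := H1_basis_rinv basB; move/matrixP/(_ (Ordinal g0) (Ordinal g0)): BC.
  rewrite !mxE eqxx big1 // => k _; have /eqP/colP/(_ (Ordinal g0)) := negbNE (B0 k).
  by rewrite !mxE => ->; rewrite mul0r.
pose N w := [exists k, (col k B != 0) && (k \in star w)].
have [e [ez Ne]] : exists e, col e B = 0 /\ (N (src e) || N (tgt e)).
  have [//|no] := pselect (exists e, col e B = 0 /\ (N (src e) || N (tgt e))).
  have Nconst k : N (src k) = N (tgt k).
    have [k0'|k0'] := eqVneq (col k B) 0.
      have : ~~ (N (src k) || N (tgt k)) by apply/negP => Nk; apply: no; exists k.
      by rewrite negb_or => /andP[/negPf-> /negPf->].
    rewrite (_ : N (src k) = true); last by apply/existsP; exists k; rewrite k0' star_src.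
    by apply/esym/existsP; exists k; rewrite k0' star_tgt.
  have := connected_const conn Nconst (src k0) (src e0).
  rewrite (_ : N (src k0) = true); last by apply/existsP; exists k0; rewrite k00 star_src.
  by move=> Ne0; exists e0; rewrite -Ne0.
have ste : src e != tgt e.
  apply/eqP => /loop_cycle/(col_eq0P basB ez); by rewrite mxE !eqxx.
have half w : N w -> exists x, half_end x = w /\ col x.1 B != 0.
  move=> /existsP[k /andP[kn]]; rewrite inE => /orP[]/eqP kw.
    by exists (k, false).
  by exists (k, true).
have other b : exists y, half_end y = half_end (e, b) /\ y.1 != e.
  have [y [_ [ye yE _ _]]] := cubic_vertex (e, b) reg; exists y; split=> //.
  apply: contraNneq ye => y1; case: y y1 yE => [k c] /= ->; case: b; case: c => //= /eqP.
    by rewrite (negPf ste).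
  by rewrite eq_sym (negPf ste).
have [x [y [xs yt xe ye xy0]]] : exists x y, [/\ half_end x = src e, half_end y = tgt e,
    x.1 != e, y.1 != e & (col x.1 B != 0) || (col y.1 B != 0)].
  have ne0 k : col k B != 0 -> k != e by apply: contra_neq => ->.
  case/orP: Ne => /half[x [xE xn]].
    have [y [yE ye]] := other true; exists x, y; split=> //; [exact: ne0 | by rewrite xn].
  have [y [yE ye]] := other false; exists y, x; split=> //; [exact: ne0 | by rewrite xn orbT].
have [src' [tgt' [B' [st' reg' basB' colk cole]]]] := whitehead_move st reg basB ste xs yt xe ye.
have [q qE] : exists q : 'I_(nv G) -> rat, forall k, q (tgt k) - q (src k) = ((k == e)%:R : int)%:~R.
  have [|q qE] := @int_potential G (delta_mx e 0).
    by move=> c /(col_eq0P basB ez) ce; rewrite -colE; apply/rowP => i; rewrite ord1 !mxE.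
  by exists q => k; rewrite qE mxE eqxx andbT.
have qk k : k != e -> k != e -> q (src k) = q (tgt k).
  by move=> /negPf ke _; have := qE k; rewrite ke => /eqP; rewrite subr_eq0 => /eqP.
have qst : q (tgt e) != q (src e) by rewrite -subr_eq0 qE eqxx.
have qhalf z : z.1 != e -> q (src z.1) = q (half_end z).
  by case: z => k [] //= ke; apply: qk.
have entry i : B i e = 0 by have /colP/(_ i) := ez; rewrite !mxE.
have evalE (a : 'rV[int]_g) : (a *m col e B') 0 0 =
    (a *m B) 0 e - half_sign x.2 * (a *m B) 0 x.1 + half_sign y.2 * (a *m B) 0 y.1.
  rewrite cole mulmxDr mulmxBr -!scalemxAr -(mul_col_entry a B e) -(mul_col_entry a B x.1).
  by rewrite -(mul_col_entry a B y.1) !mxE.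
have level i r : exists a : 'rV[int]_g, forall k,
    (a *m B) 0 k = if q (src k) == r then B i k else 0.
  have [||a aE] := H1_basis_coord basB (level_cycle r qk (row_cycle i basB) _ _).
  - by rewrite mxE.
  - by rewrite mxE.
  by exists a => k; rewrite -aE !mxE.
have sgn0 b : half_sign b != 0 by case: b.
have ne' : col e B' != 0.
  apply: contraTneq isT => c0; have eval0 (a : 'rV[int]_g) : (a *m col e B') 0 0 = 0.
    by rewrite c0 mulmx0 mxE.
  (* A cycle confined to the side of [x], respectively of [y], isolates the corresponding term of
     the new functional. *)
  have [xn|yn] := orP xy0.
    have [i xi] := col_neq0 xn; rewrite mxE in xi; have [a aE] := level i (q (src e)).
    have := eval0 a; rewrite evalE !aE entry !qhalf // xs yt eqxx (negPf qst) mulr0 addr0 sub0r.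
    by move/eqP; rewrite oppr_eq0 mulf_eq0 (negPf xi) (negPf (sgn0 _)).
  have [i yi] := col_neq0 yn; rewrite mxE in yi; have [a aE] := level i (q (tgt e)).
  have := eval0 a; rewrite evalE !aE entry !qhalf // xs yt eqxx eq_sym (negPf qst) mulr0 subr0 add0r.
  by move/eqP; rewrite mulf_eq0 (negPf yi) (negPf (sgn0 _)).
exists (Graph src' tgt'), B'; split=> //.
  move=> k; have [->|ke] := eqVneq k e; first by left.
  by right; exists k; left; apply: colk.
apply: proper_card; apply/fintype.properP; split.
  apply/fintype.subsetP => k; rewrite !inE; have [->|ke] := eqVneq k e; first by rewrite ez.
  by rewrite colk.
by exists e; rewrite !inE ?ez ?(negPf ne').
Qed.

(* Two edges with the same functional form a cut; after a Whitehead move at one of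
   them, its functional is nonzero on both sides of that cut. *)
Lemma parallel_removal g (G : graph) (B : 'M[int]_(g, ne G)) :
  stable_graph g G -> three_regular G -> H1_basis B -> (forall k, col k B != 0) ->
  (exists e f, e != f /\ (col f B = col e B \/ col f B = - col e B)) ->
  exists (G' : graph) (B' : 'M[int]_(g, ne G')),
    [/\ stable_graph g G', three_regular G', H1_basis B',
        (forall k, col k B' != 0) /\ refines B B'
      & (#|[pred p | (p.1 != p.2) && ((col p.2 B' == col p.1 B') || (col p.2 B' == - col p.1 B'))]|
         < #|[pred p | (p.1 != p.2) && ((col p.2 B == col p.1 B) || (col p.2 B == - col p.1 B))]|)%N].
Proof.
move=> st reg basB nz [e [f [ef pm]]].
have [s [s0 fE]] : exists s : int, s != 0 /\ forall c : 'rV[int]_(ne G), is_cycle c -> c 0 f = s * c 0 e.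
  case: pm => pm; [exists 1 | exists (-1)]; split=> // c /(H1_basis_coord basB)[a ->];
    rewrite -(mul_col_entry a B f) -(mul_col_entry a B e) pm ?mul1r //.
  by rewrite mulmxN mxE mulN1r.
have ste : src e != tgt e.
  apply/eqP => /loop_cycle/fE; rewrite !mxE (eq_sym f e) (negPf ef) !eqxx mulr1 => /esym/eqP.
  by rewrite (negPf s0).
have [q qE] : exists q : 'I_(nv G) -> rat,
    forall k, q (tgt k) - q (src k) = ((k == f)%:R - s * (k == e)%:R)%:~R.
  have [|q qE] := @int_potential G (delta_mx f 0 - s *: delta_mx e 0).
    move=> c cyc; rewrite mulmxBr -scalemxAr -!colE; apply/rowP => i.
    by rewrite ord1 !mxE fE // subrr.
  by exists q => k; rewrite qE !mxE !andbT.
have qk k : k != e -> k != f -> q (src k) = q (tgt k).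
  move=> /negPf ke /negPf kf; have := qE k; rewrite ke kf mulr0 subr0 => /eqP.
  by rewrite subr_eq0 => /eqP.
have qst : q (tgt e) != q (src e).
  by rewrite -subr_eq0 qE eqxx (negPf ef) sub0r mulr1 intr_eq0 oppr_eq0.
(* The half-edges at an end of e are not parallel to e: the third one would be even. *)
have side b : exists x, [/\ half_end x = half_end (e, b), x.1 != e, x.1 != f &
    ~~ par (col e B) (col x.1 B)].
  have [x [z [xn xE _ sumE]]] := cubic_vertex (e, b) reg; exists x.
  have xe : x.1 != e.
    apply: contraNneq xn => x1; case: x x1 xE {sumE} => [k c] /= ->; case: b; case: c => //= /eqP.
      by rewrite (negPf ste).
    by rewrite eq_sym (negPf ste).
  have npar : ~~ par (col e B) (col x.1 B).
    apply/negP => /(par_primitive basB basB (nz _) (nz _)) xpm.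
    have [a az] := unit_functional basB (nz z.1).
    have := cycle_at_vertex (half_end (e, b)) (H1_basis_cycle a basB).
    rewrite sumE az; rewrite -(mul_col_entry a B x.1) -(mul_col_entry a B (e, b).1) /=.
    have : (a *m col x.1 B) 0 0 = (a *m col e B) 0 0 \/ (a *m col x.1 B) 0 0 = - (a *m col e B) 0 0.
      by case: xpm => ->; [left | right; rewrite mulmxN mxE].
    move: ((a *m _) 0 0) ((a *m _) 0 0) => u w.
    by case: b {sumE xE xn}; case: (x.2); case: (z.2) => -[] ->; rewrite /half_sign; lia.
  split=> //; apply: contraNneq npar => ->; exact: par_pm.
have [x [xs xe xf xp]] := side false; have [y [yt ye yf yp]] := side true.
have [src' [tgt' [B' [st' reg' basB' colk cole]]]] := whitehead_move st reg basB ste xs yt xe ye.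
have qhalf z : z.1 != e -> z.1 != f -> q (src z.1) = q (half_end z).
  by case: z => k [] //= ke kf; apply: qk.
(* The combination given by a nonzero minor kills [e], hence [f], but not [k]; as it avoids the cut,
   it can be restricted to the side of [k]. *)
have level k r : ~~ par (col e B) (col k B) -> q (src k) = r -> exists a : 'rV[int]_g,
    [/\ (a *m B) 0 k != 0, (a *m B) 0 e = 0, (a *m B) 0 f = 0
      & forall j, q (src j) != r -> (a *m B) 0 j = 0].
  move=> /existsP[i /existsP[j ij]] kr.
  pose a : 'rV[int]_g := B i e *: delta_mx 0 j - B j e *: delta_mx 0 i.
  have aE m : (a *m B) 0 m = B i e * B j m - B j e * B i m.
    by rewrite mulmxBl -!scalemxAl -!rowE !mxE.
  have ae : (a *m B) 0 e = 0 by rewrite aE; ring.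
  have af : (a *m B) 0 f = 0 by rewrite fE ?ae ?mulr0 //; apply: H1_basis_cycle.
  have [b bE] := H1_basis_coord basB (level_cycle r qk (H1_basis_cycle a basB) ae af).
  have bk m : (b *m B) 0 m = if q (src m) == r then (a *m B) 0 m else 0 by rewrite -bE mxE.
  exists b; split; rewrite ?bk ?kr ?eqxx ?ae ?af ?if_same //.
    by rewrite aE subr_eq0; rewrite !mxE in ij.
  by move=> m /negPf mr; rewrite bk mr.
have evalE (a : 'rV[int]_g) : (a *m col e B') 0 0 =
    (a *m B) 0 e - half_sign x.2 * (a *m B) 0 x.1 + half_sign y.2 * (a *m B) 0 y.1.
  rewrite cole mulmxDr mulmxBr -!scalemxAr -(mul_col_entry a B e) -(mul_col_entry a B x.1).
  by rewrite -(mul_col_entry a B y.1) !mxE.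
have sgn0 b : half_sign b != 0 by case: b.
have xq : q (src x.1) = q (src e) by rewrite qhalf // xs.
have yq : q (src y.1) = q (tgt e) by rewrite qhalf // yt.
have [a [ax ae af aq]] := level x.1 _ xp xq; have [b [by_ be bf bq]] := level y.1 _ yp yq.
have ea : (a *m col e B') 0 0 != 0.
  rewrite evalE ae (aq y.1) ?yq // mulr0 addr0 sub0r oppr_eq0 mulf_neq0 //.
have eb : (b *m col e B') 0 0 != 0.
  by rewrite evalE be (bq x.1) ?xq 1?(eq_sym (q (src e))) // mulr0 subr0 add0r mulf_neq0.
(* The functional of [j] vanishes on the cycle chosen on the other side, where the new functional
   does not. *)
have enew j : j != e -> col j B' <> col e B' /\ col j B' <> - col e B'.
  move=> je; rewrite colk //; suff [c [ce cj]] : exists c : 'rV[int]_g,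
      (c *m col e B') 0 0 != 0 /\ (c *m col j B) 0 0 = 0.
    split=> E; move: cj; rewrite E ?mulmxN => /eqP; last rewrite mxE oppr_eq0;
      by rewrite (negPf ce).
  have [jq|jq] := eqVneq (q (src j)) (q (src e)).
    by exists b; rewrite eb mul_col_entry bq // jq eq_sym.
  by exists a; rewrite ea mul_col_entry aq.
have e0 : col e B' != 0 by apply: contraNneq ea => ->; rewrite mulmx0 mxE.
exists (Graph src' tgt'), B'; split=> //.
  split; first by move=> k; have [->//|ke] := eqVneq k e; rewrite colk.
  (* The functional lost at [e] survives, up to sign, at [f]. *)
  move=> k; right; have [->|ke] := eqVneq k e.
    by exists f; rewrite colk // eq_sym.
  by exists k; left; apply: colk.
apply: proper_card; apply/fintype.properP; split.
  apply/fintype.subsetP => -[k j]; rewrite !inE /= => /andP[kj pmkj]; rewrite kj.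
  have [ke|ke] := eqVneq k e.
    have [|n1 n2] := enew j; first by rewrite -ke eq_sym.
    by move: pmkj; rewrite ke => /orP[]/eqP.
  have [je|je] := eqVneq j e.
    have [n1 n2] := enew k ke; move: pmkj; rewrite je => /orP[]/eqP E.
      by case: n1.
    by case: n2; rewrite E opprK.
  by rewrite -!colk.
exists (e, f); rewrite !inE /= ef /=; first by case: pm => ->; rewrite eqxx ?orbT.
have [|n1 n2] := enew f; first by rewrite eq_sym.
by rewrite negb_or; apply/andP; split; apply/eqP.
Qed.

(** First the number of bridges decreases to zero, then the number of parallel pairs; the second
    phase creates no bridge. *)
Lemma cubic_refinement g (G : graph) (B : 'M[int]_(g, ne G)) :
  (2 <= g)%N -> stable_graph g G -> three_regular G -> H1_basis B ->
  exists (G' : graph) (B' : 'M[int]_(g, ne G')),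
    [/\ stable_graph g G', cubic_3connected B' & refines B B'].
Proof.
move=> g2 st reg basB.
have [G1 [B1 [st1 reg1 bas1 ref1 nz1]]] : exists (G' : graph) (B' : 'M[int]_(g, ne G')),
    [/\ stable_graph g G', three_regular G', H1_basis B', refines B B' & forall k, col k B' != 0].
  have [n] := ubnP #|[pred k | col k B == 0]|; elim: n G B st reg basB => // n IHn G B st reg basB lt.
  have [nz|] := boolP [forall k, col k B != 0].
    by exists G, B; split=> // [k|]; [right; exists k; left | apply/forallP].
  rewrite negb_forall => /existsP[k]; rewrite negbK => /eqP k0.
  have [G' [B' [st' reg' bas' ref' lt']]] := bridge_removal (ltnW g2) st reg basB (ex_intro _ k k0).
  have [G2 [B2 [? ? ? ref2 ?]]] := IHn G' B' st' reg' bas' (leq_trans lt' lt).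
  by exists G2, B2; split=> //; apply: refines_trans ref' ref2.
have [G2 [B2 [st2 reg2 bas2 ref2 sim2]]] : exists (G' : graph) (B' : 'M[int]_(g, ne G')),
    [/\ stable_graph g G', three_regular G', H1_basis B', refines B1 B' & simple_basis B'].
  have [n] := ubnP #|[pred p | (p.1 != p.2) && ((col p.2 B1 == col p.1 B1) || (col p.2 B1 == - col p.1 B1))]|.
  elim: n G1 B1 st1 reg1 bas1 nz1 {ref1} => // n IHn G1 B1 st1 reg1 bas1 nz1 lt.
  have [/existsP[e /existsP[f /andP[ef pm]]]|no] := boolP [exists e, [exists f,
      (e != f) && ((col f B1 == col e B1) || (col f B1 == - col e B1))]].
    have [|G' [B' [st' reg' bas' [nz' ref'] lt']]] := parallel_removal st1 reg1 bas1 nz1.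
      by exists e, f; split=> //; case/orP: pm => /eqP; [left | right].
    have [G2 [B2 [? ? ? ref2 ?]]] := IHn G' B' st' reg' bas' nz' (leq_trans lt' lt).
    by exists G2, B2; split=> //; apply: refines_trans ref' ref2.
  exists G1, B1; split=> //; first by move=> k; right; exists k; left.
  apply: simple_basisP => // e f ef; split=> E; case/negP: no;
    by apply/existsP; exists e; apply/existsP; exists f; rewrite ef E eqxx ?orbT.
exists G2, B2; split=> //; last exact: refines_trans ref1 ref2.
split=> //; first by case: st2.
have := stable_euler st2; have := (stable_ne_max st2).1 reg2; lia.
Qed.

(** * Primitivity *)

(* Arcs along which the unit flow z can still be augmented without using e. *)
Definition residual (G : graph) (e : 'I_(ne G)) (z : 'rV[int]_(ne G)) : rel 'I_(nv G) :=
  [rel u v | [exists f, (f != e) &&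
    ([&& src f == u, tgt f == v & z 0 f <= 0] || [&& tgt f == u, src f == v & 0 <= z 0 f])]].

(** A path without repeated vertices uses no edge twice, so each coefficient of [z] changes by at
    most one, in the direction that the residual arc allows. *)
Lemma residual_chain (G : graph) (e : 'I_(ne G)) (z : 'rV[int]_(ne G)) (v : 'I_(nv G)) p :
  (forall f, `|z 0 f| <= 1) -> path (residual e z) v p -> uniq (v :: p) ->
  exists y : 'rV[int]_(ne G),
    [/\ forall u, (y *m bdry G) 0 u = (last v p == u)%:R - (v == u)%:R,
        forall f, y 0 f != 0 -> (src f \in v :: p) && (tgt f \in v :: p),
        y 0 e = 0 & forall f, `|z 0 f + y 0 f| <= 1].
Proof.
move=> z1; elim: p v => [|w p IHp] v /=.
  move=> _ _; exists 0; split; last by move=> f; rewrite mxE addr0.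
  - by move=> u; rewrite mul0mx mxE subrr.
  - by move=> f; rewrite mxE eqxx.
  - by rewrite mxE.
move=> /andP[/existsP[f /andP[fe fvw]] pw] /andP[vwp uwp].
have [y [yb yin ye yz]] := IHp w pw uwp.
have [s [sb sz]] : exists s : int,
    (forall u, s * bdry G f u = (w == u)%:R - (v == u)%:R) /\ `|z 0 f + s| <= 1.
  have := z1 f; case/orP: fvw => /and3P[/eqP<- /eqP<- zf] zf1; [exists 1 | exists (-1)];
    by split=> [u|]; rewrite ?bdryE; [ring | lia].
have vf : (src f \in [:: v; w]) && (tgt f \in [:: v; w]).
  by case/orP: fvw => /and3P[/eqP-> /eqP-> _]; rewrite !inE !eqxx orbT.
have yf : y 0 f = 0.
  apply: contraNeq vwp => /yin/andP[sp tp].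
  by case/orP: fvw => /and3P[/eqP<- _ _].
exists (y + s *: delta_mx 0 f); split.
- move=> u; rewrite mulmxDl -scalemxAl -rowE mxE yb [X in _ + X]mxE [X in s * X]mxE sb.
  by ring.
- move=> k; rewrite !mxE eqxx /=; have [->|kf] := eqVneq k f.
    by case/andP: vf; rewrite !inE => /orP[]/eqP-> /orP[]/eqP->; rewrite !eqxx ?orbT.
  by rewrite mulr0 addr0 => /yin/andP[sk tk]; rewrite [src k \in _]in_cons [tgt k \in _]in_cons sk tk !orbT.
- by rewrite !mxE ye eq_sym (negPf fe) andbF mulr0 addr0.
- move=> k; rewrite !mxE eqxx /=; have [->|kf] := eqVneq k f.
    by rewrite yf add0r mulr1.
  by rewrite mulr0 addr0.
Qed.

(* Menger: the ends of e are joined by two edge-disjoint paths avoiding e. *)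
Lemma crossing_cycles g (G : graph) (B : 'M[int]_(g, ne G)) e : cubic_3connected B ->
  exists z w : 'rV[int]_(ne G),
    [/\ is_cycle z, is_cycle w, z 0 e * w 0 e = 1 & forall f, f != e -> z 0 f * w 0 f = 0].
Proof.
move=> [conn _ _ basB simB].
have [x [xe x1]] := short_unit_functional basB (simB.1 e).
have zc := H1_basis_cycle x basB; move: (x *m B) xe x1 zc => z ze z1 zc.
(* Otherwise let [X] be the set reachable from the target of [e]. Every further cut edge carries one
   unit against that of [e]; there are at least two of them, so the flow across the cut cannot
   balance. *)
have : connect (residual e z) (tgt e) (src e).
  apply: contraT => nXs; pose X v := connect (residual e z) (tgt e) v.
  have Xt : X (tgt e) by apply: connect0.
  have arc u v : X u -> residual e z u v -> X v.
    by move=> Xu uv; apply: connect_trans Xu (connect1 uv).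
  have eX : e \in cut X by rewrite inE Xt (_ : X (src e) = false) //; apply: negbTE.
  have := cut_cycle_sum X zc; rewrite (bigD1 e) //= ze.
  rewrite Xt (_ : X (src e) = false); last exact: negbTE.
  rewrite (eq_bigr (fun=> -1)) => [|f /andP[]]; last first.
    rewrite inE => fX fe; have := z1 f.
    have := arc (src f) (tgt f); have := arc (tgt f) (src f).
    have rts : 0 <= z 0 f -> residual e z (tgt f) (src f).
      by move=> zf; apply/existsP; exists f; rewrite fe !eqxx zf orbT.
    have rst : z 0 f <= 0 -> residual e z (src f) (tgt f).
      by move=> zf; apply/existsP; exists f; rewrite fe !eqxx zf.
    move: fX rts rst; move: (X (src f)) (X (tgt f)) (residual e z _ _) (residual e z _ _) (z 0 f).
    move=> [] [] //= r1 r2 zf _ h1 h2 h3 h4 zf1.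
      by case: (lerP zf 0) => zf0; [have := h4 isT (h2 zf0) | lia].
    by case: (lerP 0 zf) => zf0; [have := h3 isT (h1 zf0) | lia].
  have := cut_ge3 conn basB simB Xt nXs.
  rewrite sumr_const -(cardsE [pred f | (f \in cut X) && (f != e)]).
  rewrite (_ : [set f in _] = cut X :\ e)%SET; last by apply/setP => f; rewrite !inE andbC.
  by rewrite (cardsD1 e) eX; move: #|_| => n; lia.
case/connectP => p; case/shortenP => p' pathp' uniqp' _ pE.
have [y [yb _ ye yz]] := residual_chain z1 pathp' uniqp'.
(* Closing the augmenting path by [e] gives a cycle with value 2 at [e] and at most 1 in absolute
   value elsewhere. A conformal piece through [e] and the remainder are the two cycles. *)
pose c := z + y + delta_mx 0 e.
have cc : is_cycle c.
  rewrite /is_cycle /c !mulmxDl zc add0r -rowE; apply/rowP => u.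
  rewrite [LHS]mxE yb -pE [X in _ + X]mxE bdryE mxE.
  by ring.
have ce : c 0 e = 2 by rewrite !mxE ze ye !eqxx.
have c1 f : f != e -> `|c 0 f| <= 1 by move=> fe; rewrite !mxE (negPf fe) andbF addr0.
clearbody c; have [cs [csP cE csn]] := cycle_decomposition cc.
have /hasP[w wcs we] : has (fun w : 'rV[int]_(ne G) => w 0 e != 0) cs.
  apply: contraT => /hasPn cs0; move: (csn e); rewrite ce big1_seq // => w /= /cs0.
  by rewrite negbK => /eqP ->; rewrite normr0.
have [wc _ w1] := csP w wcs.
have wn f : `|c 0 f - w 0 f| + `|w 0 f| <= `|c 0 f|.
  have cE' : c = w + \sum_(y <- rem w cs) y by rewrite {1}cE (perm_big _ (perm_to_rem wcs)) big_cons.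
  rewrite csn (perm_big _ (perm_to_rem wcs)) big_cons [leLHS]addrC lerD2l.
  have -> : c 0 f - w 0 f = \sum_(y <- rem w cs) y 0 f.
    by rewrite cE' mxE summxE addrC addKr.
  exact: ler_norm_sum.
exists w, (c - w); split=> //; first by rewrite /is_cycle mulmxBl cc wc subrr.
  by have := wn e; have := w1 e; rewrite !mxE ce; move: (w 0 e) we => a; nia.
move=> f fe; have := wn f; have := c1 f fe; rewrite [(c - w) 0 f]mxE [(- w) 0 f]mxE.
by move: (c 0 f) (w 0 f) => a b; nia.
Qed.

Lemma torelli_primitive (R : realType) g (G : graph) (B B' : 'M[int]_(g, ne G)) :
  cubic_3connected B -> H1_basis B' -> primitive_map (torelli_linear (R := R) B').
Proof.
move=> cub basB'; apply/seteqP; split=> l /=; last first.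
  move=> lint; apply/mxOverP => i j; rewrite mxE; apply: rpred_sum => e _.
  by rewrite !rpredM // ?mxE ?intr_int //; apply: (mxOverP lint).
move=> Qint; apply/mxOverP => i e; rewrite ord1.
have [z [w [zc wc zwe zw0]]] := crossing_cycles e cub.
have [a aE] := H1_basis_coord basB' zc; have [b bE] := H1_basis_coord basB' wc.
have -> : l 0 e = (map_mx intr a *m torelli_linear B' l *m (map_mx intr b)^T) 0 0.
  rewrite torelli_linear_form -!map_mxM -aE -bE (bigD1 e) //= big1 => [|f fe].
    by rewrite !mxE addr0 -mulrA -intrM zwe mulr1.
  by rewrite !mxE -mulrA -intrM zw0 ?mulr0.
rewrite mxE; apply: rpred_sum => j _; rewrite rpredM //; last by rewrite !mxE intr_int.
rewrite mxE; apply: rpred_sum => k _; rewrite rpredM //; first by rewrite mxE intr_int.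
exact: (mxOverP Qint).
Qed.

(** * Generic points *)

Import numFieldNormedType.Exports.
Local Open Scope classical_set_scope.

Lemma stable_basis g (G : graph) : stable_graph g G -> exists B : 'M[int]_(g, ne G), H1_basis B.
Proof. by case=> _ <- _; have [B [basB _]] := H1_basis_exists G; exists B. Qed.

Lemma cubic_3connectedI g (G : graph) (B : 'M[int]_(g, ne G)) :
  (2 <= g)%N -> stable_graph g G -> three_regular G -> H1_basis B -> simple_basis B ->
  cubic_3connected B.
Proof.
move=> g2 st reg basB simB; split=> //; first by case: st.
by have := stable_euler st; have := (stable_ne_max st).1 reg; lia.
Qed.

Lemma par_unit g (P : 'M[int]_g) (u v : 'cV[int]_g) :
  P \in unitmx -> par (P *m u) (P *m v) -> par u v.
Proof.
move=> Pu pP; apply/parP => i j.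
have := mulmx_par (row i (invmx P)) (row j (invmx P)) pP.
have rE k (w : 'cV[int]_g) : (row k (invmx P) *m (P *m w)) 0 0 = w k 0.
  by rewrite -row_mul mulKmx // mxE.
by rewrite !rE.
Qed.

Lemma simple_basis_unit g n (P : 'M[int]_g) (B : 'M[int]_(g, n)) :
  P \in unitmx -> simple_basis B -> simple_basis (P *m B).
Proof.
have colM e : col e (P *m B) = P *m col e B by rewrite colE -mulmxA -colE.
move=> Pu [B0 Bp]; split=> [e|e f ef]; rewrite !colM.
  by apply: contra_neq (B0 e) => PB; rewrite -[LHS](mulKmx Pu) PB mulmx0.
by apply: contra (Bp e f ef); apply: par_unit.
Qed.

Lemma torelli_linear_unit (R : realType) g (G : graph) (P : 'M[int]_g) (B : 'M[int]_(g, ne G))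
    (l : 'rV[R]_(ne G)) :
  torelli_linear (P *m B) l = map_mx intr P *m torelli_linear B l *m (map_mx intr P)^T.
Proof. by rewrite !torelli_linearE map_mxM trmx_mul !mulmxA. Qed.

Lemma posdef_torelli (R : realType) g (G : graph) (B : 'M[int]_(g, ne G)) (l : 'rV[R]_(ne G)) :
  H1_basis B -> positive_lengths l -> posdef (torelli_linear B l).
Proof.
move=> basB lp; split.
  by rewrite torelli_linearE !trmx_mul trmxK tr_diag_mx mulmxA.
move=> x x0; rewrite torelli_linear_form; have [C BC] := H1_basis_rinv basB.
have ge0 e : true -> 0 <= l 0 e * (x *m map_mx intr B) 0 e * (x *m map_mx intr B) 0 e.
  by move=> _; rewrite -mulrA -expr2 mulr_ge0 ?sqr_ge0 // ltW //; apply: lp.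
rewrite lt_def sumr_ge0 // andbT; apply: contra x0 => /eqP s0.
have xB : x *m map_mx intr B = 0.
  apply/rowP => e; rewrite [RHS]mxE; have /eqP := @psumr_eq0P _ _ _ _ ge0 s0 e isT.
  by rewrite -mulrA mulf_eq0 gt_eqF ?lp //= mulf_eq0 orbb => /eqP.
by rewrite -[x]mulmx1 -(map_mx1 (intr : int -> R)) -BC map_mxM mulmxA xB mul0mx.
Qed.

Lemma qform_sum (R : realType) g (Q : 'M[R]_g) (z : 'rV[int]_g) :
  qform Q z = \sum_i \sum_j (z 0 i)%:~R * (z 0 j)%:~R * Q i j.
Proof.
rewrite /qform mxE exchange_big /=; apply: eq_bigr => j _.
rewrite mxE mulr_suml; apply: eq_bigr => i _.
by rewrite !mxE; ring.
Qed.

(** The coordinates of [z] are recovered from [z *m B] by a right inverse [C], so their products are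
    bounded by a multiple of the norm of [z]; an entrywise error thus becomes a relative one. *)
Lemma qform_near (R : realType) g (G : graph) (B : 'M[int]_(g, ne G)) (l : 'rV[R]_(ne G)) (dl : R) :
  H1_basis B -> positive_lengths l -> 0 < dl ->
  exists2 eps : R, 0 < eps & forall Q : 'M[R]_g,
    (forall i j, `|Q i j - torelli_linear B l i j| <= eps) ->
    forall z, (1 - dl) * qform (torelli_linear B l) z <= qform Q z
              <= (1 + dl) * qform (torelli_linear B l) z.
Proof.
move=> basB lp dl0; have [C BC] := H1_basis_rinv basB.
have [m m0 ml] := finite_lower_bound lp.
set Q0 := torelli_linear B l.
pose K i : R := \sum_e `|C e i|%:~R.
pose S := \sum_i \sum_j K i * K j.
have K0 i : 0 <= K i by apply: sumr_ge0 => e _; rewrite ler0z.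
have S0 : 0 <= S by apply: sumr_ge0 => i _; apply: sumr_ge0 => j _; apply: mulr_ge0.
exists (dl * m / (S + 1)); first by rewrite divr_gt0 ?mulr_gt0 // ltr_wpDl.
set eps := _ / _ => Q near z.
have eps0 : 0 <= eps by rewrite divr_ge0 ?mulr_ge0 ?addr_ge0 // ltW.
have Q0ge e : l 0 e * ((z *m B) 0 e ^+ 2)%:~R <= qform Q0 z.
  rewrite qformE (bigD1 e) //= lerDl; apply: sumr_ge0 => f _.
  by rewrite mulr_ge0 ?ler0z ?sqr_ge0 // ltW //; apply: lp.
have Q00 : 0 <= qform Q0 z.
  rewrite qformE; apply: sumr_ge0 => f _.
  by rewrite mulr_ge0 ?ler0z ?sqr_ge0 // ltW //; apply: lp.
have ze e : `|(z *m B) 0 e|%:~R ^+ 2 <= qform Q0 z / m.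
  rewrite ler_pdivlMr // -rmorphXn /= real_normK ?num_real // mulrC; apply: le_trans (Q0ge e).
  by rewrite ler_wpM2r ?ler0z ?sqr_ge0.
have yy e f : `|(z *m B) 0 e|%:~R * `|(z *m B) 0 f|%:~R <= qform Q0 z / m.
  have := ze e; have := ze f; set u : R := `|(z *m B) 0 e|%:~R; set v : R := `|(z *m B) 0 f|%:~R.
  have := sqr_ge0 (u - v); nra.
have zi i : `|(z 0 i)%:~R| <= \sum_e `|(z *m B) 0 e|%:~R * `|C e i|%:~R :> R.
  have -> : z 0 i = \sum_e (z *m B) 0 e * C e i by rewrite -[in LHS](mulmx1 z) -BC mulmxA mxE.
  rewrite raddf_sum; apply: le_trans (ler_norm_sum _ _ _) _; apply: ler_sum => e _ /=.
  by rewrite intrM normrM !intr_norm.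
have zz i j : `|(z 0 i)%:~R * (z 0 j)%:~R| <= K i * K j * (qform Q0 z / m) :> R.
  rewrite normrM; apply: le_trans (ler_pM _ _ (zi i) (zi j)) _ => //.
  rewrite /K !big_distrlr mulr_suml; apply: ler_sum => e _; rewrite mulr_suml.
  apply: ler_sum => f _; rewrite [leLHS]mulrACA [leLHS]mulrC.
  by rewrite ler_wpM2l ?mulr_ge0 ?ler0z ?yy.
have diff : `|qform Q z - qform Q0 z| <= dl * qform Q0 z.
  have -> : qform Q z - qform Q0 z = \sum_i \sum_j (z 0 i)%:~R * (z 0 j)%:~R * (Q i j - Q0 i j).
    rewrite !qform_sum -sumrB; apply: eq_bigr => i _; rewrite -sumrB.
    by apply: eq_bigr => j _; ring.
  apply: le_trans (ler_norm_sum _ _ _) _.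
  apply: le_trans (_ : _ <= \sum_i \sum_j K i * K j * (qform Q0 z / m) * eps) _.
    apply: ler_sum => i _; apply: le_trans (ler_norm_sum _ _ _) _.
    by apply: ler_sum => j _; rewrite normrM ler_pM.
  under eq_bigr do rewrite -!mulr_suml.
  rewrite -!mulr_suml -/S /eps.
  have -> : S * (qform Q0 z / m) * (dl * m / (S + 1)) = dl * qform Q0 z * (S / (S + 1)).
    by field; rewrite !gt_eqF // ltr_wpDl.
  rewrite ler_piMr ?mulr_ge0 //; first exact: ltW.
  by rewrite ler_pdivrMr ?ltr_wpDl // mul1r lerDl.
by move: diff; rewrite ler_norml => /andP[h1 h2]; apply/andP; split; lra.
Qed.

(** Edges of [G] with the same functional pool their lengths, and bridges are dropped. An edge of
    [G'] without counterpart gets length zero, so strict positivity is lost. *)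
Lemma refined_lengths (R : realType) g (G G' : graph) (B : 'M[int]_(g, ne G))
    (B' : 'M[int]_(g, ne G')) (l : 'rV[R]_(ne G)) : positive_lengths l -> refines B B' ->
  exists l' : 'rV[R]_(ne G'), (forall e, 0 <= l' 0 e) /\ torelli_linear B l = torelli_linear B' l'.
Proof.
move=> lp ref.
have /fin_all_exists[s sP] : forall k, exists o : option 'I_(ne G'),
    if o is Some k' then col k' B' = col k B \/ col k' B' = - col k B else col k B = 0.
  by move=> k; have [k0|[k' k'E]] := ref k; [exists None | exists (Some k')].
exists (\row_k' \sum_(k | s k == Some k') l 0 k); split.
  by move=> e; rewrite mxE; apply: sumr_ge0 => k _; rewrite ltW //; apply: lp.
apply/matrixP => i j; rewrite !mxE /scalar_product.
under [RHS]eq_bigr do rewrite mxE mulr_suml mulr_suml big_mkcond.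
rewrite exchange_big /=; apply: eq_bigr => k _.
have := sP k; case: (s k) => [k' k'E|/colP k0].
  rewrite (bigD1 k') //= eqxx big1 => [|k'' ne]; last by rewrite -[Some _ == _]/(k' == k'') eq_sym (negPf ne).
  rewrite addr0 !mxE; case: k'E => /colP E; have := E i; have := E j; rewrite !mxE => -> ->; first by [].
  by rewrite !intrN; ring.
rewrite big1 ?mxE => [|k' _]; last by [].
by have := k0 i; rewrite !mxE => ->; rewrite mulr0 mul0r.
Qed.

(** Quantifying over all curves above [a] makes this a condition on points of [A], whose interior
    serves for both halves of the theorem. *)
Definition torelli_good (R : realType) g (M A : topologicalType)
    (mcls : forall G : graph, 'rV[R]_(ne G) -> M) (t : M -> A) : set A :=
  [set a | forall (G : graph) (l : 'rV[R]_(ne G)), tropical_curve g l -> t (mcls G l) = a ->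
     exists B : 'M[int]_(g, ne G), cubic_3connected B].

(** The chart of [A] is open, so points near the given one have Gram matrices near that of [G0]. The
    isometry relating such a matrix to that of a curve is absorbed into the basis, and since [G0]
    has the maximal number of edges, [simple_basis_near] applies. *)
Lemma torelli_good_nbhs (R : realType) g (M A : topologicalType)
    (mcls : forall G : graph, 'rV[R]_(ne G) -> M) (acls : 'M[R]_g -> A) (t : M -> A)
    (G0 : graph) (B0 : 'M[int]_(g, ne G0)) (l0 : 'rV[R]_(ne G0)) :
  (2 <= g)%N -> ppav_moduli acls -> torelli_map mcls acls t ->
  stable_graph g G0 -> cubic_3connected B0 -> positive_lengths l0 ->
  nbhs (acls (torelli_linear B0 l0)) (torelli_good g mcls t).
Proof.
move=> g2 Amod tor st0 [_ reg0 _ bas0 sim0] lp0.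
have [dl dl0 simp] := simple_basis_near bas0 sim0 lp0.
have [eps eps0 epsP] := qform_near bas0 lp0 dl0.
set Q0 := torelli_linear B0 l0 in epsP *.
pose W : set 'M[R]_g := (ball Q0 eps)^°.
have Wo : open W by apply: open_interior.
have WQ0 : W Q0 by apply: nbhsx_ballx.
have : nbhs (acls Q0) (acls @` (@posdef R g `&` W)).
  apply: open_nbhs_nbhs; split; first exact: (ppav_open Amod).
  by exists Q0 => //; split=> //; apply: posdef_torelli.
apply: filterS => _ [Q [Qpos WQ] <-] G l [st lp] tE.
have [B basB] := stable_basis st.
move: tE; rewrite (torelli_jacobian tor (conj st lp) basB).
move/(ppav_inj Amod (posdef_torelli basB lp) Qpos) => [P Pu QE].
have basP := H1_basis_unit Pu basB.
have neG : (ne G <= ne G0)%N.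
  by have := stable_ne_leq st; have := (stable_ne_max st0).1 reg0; lia.
have near : forall z, (1 - dl) * qform Q0 z <= qform (torelli_linear (P *m B) l) z
    <= (1 + dl) * qform Q0 z.
  apply: epsP => i j; rewrite torelli_linear_unit -QE; have := interior_subset WQ.
  by case=> _ /(_ i j); rewrite /ball /= distrC => /ltW.
have [neE sim] := simp _ _ _ basP lp neG near.
exists (P *m B); apply: cubic_3connectedI => //.
by apply/(stable_ne_max st); rewrite neE; apply/(stable_ne_max st0).
Qed.

(** Curves with isometric Jacobians get equal Gram matrices after a change of basis; the edges with
    their lengths match first, then the vertices through their stars. *)
Lemma torelli_good_unique (R : realType) g (M A : topologicalType)
    (mcls : forall G : graph, 'rV[R]_(ne G) -> M) (acls : 'M[R]_g -> A) (t : M -> A) a :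
  curve_moduli g mcls -> ppav_moduli acls -> torelli_map mcls acls t ->
  torelli_good g mcls t a ->
  forall (G : graph) (l : 'rV[R]_(ne G)), tropical_curve g l -> t (mcls G l) = a ->
    t @^-1` [set a] = [set mcls G l].
Proof.
move=> Mmod Amod tor good G l cur tE; apply/seteqP; split=> x /=; last by move=> ->.
have [G' [l' [cur' <-]]] := curve_surj Mmod x => tE'.
have [B cub] := good G l cur tE; have [B' cub'] := good G' l' cur' tE'.
have [_ reg _ basB simB] := cub; have [_ reg' _ basB' simB'] := cub'.
have [st lp] := cur; have [st' lp'] := cur'.
have : acls (torelli_linear B l) = acls (torelli_linear B' l').
  by rewrite -(torelli_jacobian tor cur basB) -(torelli_jacobian tor cur' basB') tE tE'.
move/(ppav_inj Amod (posdef_torelli basB lp) (posdef_torelli basB' lp')) => [P Pu].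
rewrite -torelli_linear_unit => /esym QE.
have cubP : cubic_3connected (P *m B).
  by case: cub => ? ? ? ? ?; split=> //; [apply: H1_basis_unit | apply: simple_basis_unit].
have [_ _ _ basP simP] := cubP.
have [h [h_inj hP]] := torelli_edges basP basB' simP simB' lp lp' QE.
have neE : ne G = ne G'.
  have := stable_ne_leq st; have := stable_ne_leq st'.
  by have := (stable_ne_max st).1 reg; have := (stable_ne_max st').1 reg'; lia.
have h_bij : bijective h by apply: inj_card_bij => //; rewrite !card_ord neE.
have nvE : nv G = nv G' by have := stable_euler st; have := stable_euler st'; lia.
have [|f f_bij fj] := edge_match_joins cubP cub' _ nvE (h := h).
  by split=> // e; case: (hP e).
by apply/esym/(curve_inj Mmod cur cur'); exists f, h; split=> // e; case: (hP e).
Qed.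

(** A point of the image is approximated by that of a 3-regular curve, by continuity of [t]. A
    refinement has the same Gram matrix with lengths possibly zero; lengthening all edges by a small
    [eta] gives a good curve nearby. *)
Lemma torelli_good_dense (R : realType) g (M A : topologicalType)
    (mcls : forall G : graph, 'rV[R]_(ne G) -> M) (acls : 'M[R]_g -> A) (t : M -> A) :
  (2 <= g)%N -> curve_moduli g mcls -> ppav_moduli acls -> torelli_map mcls acls t ->
  range t `<=` closure (range t `&` (torelli_good g mcls t)^°).
Proof.
move=> g2 Mmod Amod tor _ [x _ <-] V Vx.
have Vo : open V^° by apply: open_interior.
have [U [_ Ud Ucub]] := curve_generic Mmod.
have nbx : nbhs x (t @^-1` V^°).
  by apply: (torelli_continuous tor); apply: nbhs_interior.
have [y [[_ Uy] Vy]] := Ud x I _ nbx.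
have [G [l [[st lp] reg yE]]] := Ucub y I Uy; have [B basB] := stable_basis st.
move: Vy; rewrite /= -yE (torelli_jacobian tor (conj st lp) basB).
have [G' [B' [st' cub' ref]]] := cubic_refinement g2 st reg basB.
have [_ _ _ basB' _] := cub'.
have [l' [l'0 QE]] := refined_lengths lp ref.
have [W Wo WP] := ppav_cont Amod Vo.
move/(WP _ (posdef_torelli basB lp)) => WQ.
have /nbhs_ballP[d /= d0 dW] : nbhs (torelli_linear B l) W by apply: open_nbhs_nbhs.
pose T := torelli_linear B' (const_mx 1 : 'rV[R]_(ne G')).
pose s := \sum_i \sum_j `|T i j|.
have s0 : 0 <= s by apply: sumr_ge0 => i _; apply: sumr_ge0.
have Ts i j : `|T i j| <= s.
  rewrite /s (bigD1 i) //= (bigD1 j) //= -addrA lerDl addr_ge0 ?sumr_ge0 // => k _.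
  by apply: sumr_ge0.
pose eta := d / (s + 1).
have eta0 : 0 < eta by rewrite divr_gt0 // ltr_wpDl.
pose l1 : 'rV[R]_(ne G') := l' + eta *: const_mx 1.
have lp1 : positive_lengths l1 by move=> e; rewrite !mxE mulr1 ltr_wpDl.
have TE : torelli_linear B' l1 = torelli_linear B l + eta *: T.
  rewrite QE /T; apply/matrixP => i j; rewrite 4!mxE [torelli_linear B' (const_mx 1) i j]mxE.
  rewrite /scalar_product mulr_sumr -big_split /=; apply: eq_bigr => e _; rewrite !mxE; ring.
clearbody T; have W1 : W (torelli_linear B' l1).
  apply: dW; split=> // i j; rewrite TE /ball /= !mxE opprD addrA subrr sub0r normrN normrM gtr0_norm //.
  rewrite /eta mulrAC ltr_pdivrMr ?ltr_wpDl // ltr_pM2l //; apply: le_lt_trans (Ts i j) _.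
  by rewrite ltrDl.
have cur1 : tropical_curve g l1 by [].
exists (acls (torelli_linear B' l1)); split; last first.
  by apply: interior_subset; apply/(WP _ (posdef_torelli basB' lp1)).
split; first by exists (mcls G' l1) => //; rewrite (torelli_jacobian tor cur1 basB').
exact: torelli_good_nbhs g2 Amod tor st' cub' lp1.
Qed.

Theorem theoremA2p1 (R : realType) (g : nat) (g_ge2 : (2 <= g)%N)
    (M A : topologicalType)
    (mcls : forall G : graph, 'rV[R]_(ne G) -> M) (acls : 'M[R]_g -> A)
    (t : M -> A)
    (M_moduli : curve_moduli g mcls)
    (A_moduli : ppav_moduli acls)
    (t_torelli : torelli_map mcls acls t) :
  generically (range t) (fun a : A =>
    forall (G : graph) (l : 'rV[R]_(ne G)),
      tropical_curve g l -> t (mcls G l) = a ->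
      t @^-1` [set a] = [set mcls G l])
  /\
  generically (range t) (fun a : A =>
    forall (G : graph) (l : 'rV[R]_(ne G)),
      tropical_curve g l -> t (mcls G l) = a ->
      three_regular G /\
      forall B : 'M[int]_(g, ne G), H1_basis B ->
        primitive_map (torelli_linear (R := R) B)).
Proof.
have dense := torelli_good_dense g_ge2 M_moduli A_moduli t_torelli.
split; exists (torelli_good g mcls t)^°; (split; [exact: open_interior | exact: dense |]).
  move=> a _ /interior_subset good.
  exact: (torelli_good_unique M_moduli A_moduli t_torelli good).
move=> a _ /interior_subset good G l cur tE; have [B cub] := good G l cur tE.
split; first by case: cub.
by move=> B' basB'; apply: torelli_primitive cub basB'.
Qed.
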